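(* There are no tight chiral $5$-polytopes.
   Context: An abstract $n$-polytope is a partially ordered set with a unique least face (rank $-1$) and greatest face (rank $n$) in which every maximal chain (flag) has $n+2$ elements, satisfying the diamond condition (whenever $F<G$ with ranks differing by $2$ there are exactly two faces strictly between them) and strong connectivity. Faces of rank $0$ are vertices, of rank $n-1$ facets. A polytope is equivelar of (Schläfli) type $\{p_1,\dots,p_{n-1}\}$ if for each $i$ every section between an $(i-2)$-face and an incident $(i+1)$-face is a $p_i$-gon. An automorphism is an order-preserving bijection; $\Gamma(\mathcal P)$ is the automorphism group. $\mathcal P$ is regular if $\Gamma(\mathcal P)$ is transitive on flags, and chiral if $\Gamma(\mathcal P)$ has exactly two orbits on flags with any two flags differing in exactly one face lying in different orbits. A polytope of type $\{p_1,\dots,p_{n-1}\}$ has at least $2p_1\cdots p_{n-1}$ flags, and it is called tight if it has exactly $2p_1\cdots p_{n-1}$ flags. *)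

(* Defs.v *)
From mathcomp Require Import all_boot all_order all_algebra all_fingroup.
Set Implicit Arguments. Unset Strict Implicit. Unset Printing Implicit Defensive.
Import GRing.Theory Num.Theory.

Section Polytopes.
Variable T : finType.
Variable le : rel T.
Variable rk : T -> int.

Definition ltP (x y : T) : bool := le x y && (x != y).
Definition incident (x y : T) : bool := le x y || le y x.

Definition partial_order : Prop :=
  [/\ (forall x, le x x),
      (forall x y, le x y -> le y x -> x = y) &
      (forall x y z, le x y -> le y z -> le x z)].

Definition is_chain (C : {set T}) : bool :=
  [forall x in C, [forall y in C, incident x y]].

Definition is_flag (C : {set T}) : bool :=
  is_chain C && [forall z, (z \notin C) ==> [exists x in C, ~~ incident x z]].

Definition flags : {set {set T}} := [set C | is_flag C].

Definition open_section (F G : T) : {set T} := [set x | ltP F x && ltP x G].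

(* a section G/F (of rank rk G - rk F - 1) is connected if its rank is <= 1,
   or any two proper faces are joined by a sequence of proper faces of the
   section, consecutive ones being incident *)
Definition section_connected (F G : T) : Prop :=
  (rk G - rk F - 1 >= 2)%R ->
  forall x y, x \in open_section F G -> y \in open_section F G ->
  exists s : seq T, [/\ path incident x s, last x s = y &
                        all (fun z => z \in open_section F G) s].

Definition strongly_connected : Prop :=
  forall F G, le F G -> section_connected F G.

Definition is_polytope (n : nat) : Prop :=
  [/\ partial_order,
      (exists F0, forall x, le F0 x),
      (exists Fn, forall x, le x Fn),
      (forall x, (-1 <= rk x)%R /\ (rk x <= n%:Z)%R)
    & (forall x y, ltP x y -> (rk x < rk y)%R)] /\
  [/\ (forall C, is_flag C -> #|C| = n.+2),
      (forall F G, le F G -> rk G = (rk F + 2)%R -> #|open_section F G| = 2)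
    & strongly_connected].

(* equivelar of type {p 1, ..., p (n-1)}: each section between an (i-2)-face
   and an incident (i+1)-face is a (p i)-gon, i.e. has p i faces of rank i-1
   (its vertices) *)
Definition equivelar (n : nat) (p : nat -> nat) : Prop :=
  forall i : nat, 1 <= i <= n.-1 ->
  forall F G, le F G -> rk F = (i%:Z - 2)%R -> rk G = (i%:Z + 1)%R ->
  #|[set x | le F x && le x G && (rk x == (i%:Z - 1)%R)]| = p i.

Definition is_aut (f : {perm T}) : bool :=
  [forall x, [forall y, le (f x) (f y) == le x y]].

Definition flag_orbit (C : {set T}) : {set {set T}} :=
  [set D in flags | [exists f : {perm T}, is_aut f && (f @: C == D)]].

Definition flag_orbits : {set {set {set T}}} := [set flag_orbit C | C in flags].

Definition regular : Prop := #|flag_orbits| = 1.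

Definition chiral : Prop :=
  #|flag_orbits| = 2 /\
  forall C D, C \in flags -> D \in flags -> #|C :\: D| = 1 ->
    flag_orbit C != flag_orbit D.

Definition tight (n : nat) (p : nat -> nat) : Prop :=
  #|flags| = 2 * \prod_(1 <= i < n) p i.

End Polytopes.

(* Main.v *)
Require Import Defs.
From mathcomp Require Import all_boot all_order all_algebra all_fingroup.
From mathcomp Require Import zify.
Set Implicit Arguments. Unset Strict Implicit. Unset Printing Implicit Defensive.
Import GRing.Theory Num.Theory.

(**
Let [a, b, c, d] be the standard rotations of a tight chiral 5-polytope. Chirality and
tightness make the automorphism group equal to [<a><b><c><d>] with unique factorizations,
so [c^-1 b = b^i c^j] for some [i, j], and the mirror image of this relation is
[b c^-1 = c^j b^i]. The involution [b c d] inverts [a] and [b], that is, the 3-faces are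
regular; this alone forces [b c^-1 = c^m b^i] for some [m]. By duality (the involution
[a b c] inverts [c] and [d]) the other exponent is [j], whence [m = j]. All defining
relations are then invariant under the formal reflection
[a -> b^-1 a^-1 b, b -> b^-1, c -> c^-1, d -> c d^-1 c^-1], which therefore extends to
an automorphism of the group and induces an automorphism of the polytope that moves the
base flag to an adjacent one, contradicting chirality.
*)

(** The one-sided step conjugates [c^-1 b = b^i c^j] by the involution [a b], which inverts [c] but
    sends [b] to [T = b^-1 a^-2], so powers of [T] have to be brought back into [<b><c>]. With
    [P = a^(x+1)], the square of [T] is [b^-2 Q^-1] modulo [<P>], where [Q] is a power of [b]. Since
    [<a>] meets [<b><c>] trivially, a congruence modulo [<P>] between elements of [<b><c>] is an
    equality. For even [i] the mirror relation falls out at once. For odd [i] correction terms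
    remain, built from [Q] and its conjugates under [c]; they must be shown to commute and to
    combine into a power of [c]. This spoils the exponent of [c] but not that of [b], which is why
    duality has to supply the former.

    No presentation of the automorphism group is used. The reflection is the subgroup of the direct
    square generated by the pairs (generator, image); a factorization of this subgroup into four
    cyclic factors, matched with the unique one of the group itself, shows that it is the graph of a
    map. *)

(** * Transporting relations along a conjugation *)

Section Intertwining.
Local Open Scope group_scope.
Variable gT : finGroupType.
Implicit Types g h x y z : gT.

Lemma intertwineM g x x' y y' :
  g * x = y * g -> g * x' = y' * g -> g * (x * x') = y * y' * g.
Proof. by move=> h h'; rewrite mulgA h -mulgA h' mulgA. Qed.

Lemma intertwineV g x y : g * x = y * g -> g * x^-1 = y^-1 * g.
Proof. by move=> h; apply: (mulgI y); apply: (mulIg x); rewrite mulKVg -!mulgA mulVg mulg1 h. Qed.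

Lemma intertwineX g x y n : g * x = y * g -> g * x ^+ n = y ^+ n * g.
Proof.
move=> h; elim: n => [|n IHn]; first by rewrite !expg0 mulg1 mul1g.
by rewrite !expgS; apply: intertwineM.
Qed.

Lemma involutive_mul g h : g * h * (g * h) = 1 -> g * h = h^-1 * g^-1.
Proof. by move=> e; rewrite -invgM; apply/eqP; rewrite eq_sym eq_invg_mul e. Qed.

Lemma involutive_mulC g h : g * h * (g * h) = 1 -> h * g = g^-1 * h^-1.
Proof. by move=> e; apply: (mulgI g); apply: (mulIg h); move: e; rewrite !gnorm. Qed.

End Intertwining.

(** * The mirror relation up to the exponent of [c] *)

Module OneSided.
Local Open Scope group_scope.

(** A computation in an abelian group. The first equation times [v], compared with the square of the
    second, gives [v1 v v^(2n) = u^(2n) v^(2n)]; the product of the last two equations then gives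
    the other claim. It is applied to [Q] and its conjugates by [c] and [c^-1]. *)
Lemma commuting_products (gT : finGroupType) (u v v1 : gT) n :
    commute u v -> commute u v1 -> commute v v1 ->
    v1 * (u^-1 * v ^+ n) ^+ 2 = v -> u ^+ n * v ^+ n = u * v ->
    u ^+ n * v1 ^+ n = u * v1 ->
  v1 * v = (u ^+ n) ^+ 2 /\ v ^+ n * v1 ^+ n = u ^+ 2.
Proof.
move=> uv uv1 vv1 e1 e2 e3.
have uVv k : commute u^-1 (v ^+ k).
  by apply: commuteX; apply: commute_sym; apply: commuteV; apply: commute_sym.
have unvn k : commute (u ^+ k) (v ^+ n).
  by apply: commute_sym; apply: commuteX; apply: commute_sym; apply: commuteX.
have e4 : v1 * (v ^+ n) ^+ 2 = v * u ^+ 2.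
  rewrite -{2}e1 expgMn // expgVn; move: (commuteX 2 (unvn 2)).
  by move: (u ^+ 2) ((v ^+ n) ^+ 2) => U2 V2 UV; rewrite -!mulgA -UV mulKg.
have E : v1 * v = (u ^+ n) ^+ 2.
  apply: (mulIg ((v ^+ n) ^+ 2)); rewrite -expgMn // e2 expgMn // -[v ^+ 2]/(v * v).
  have vv : commute v ((v ^+ n) ^+ 2) by do 2!apply: commuteX.
  have vu : commute v (u ^+ 2) by apply: commuteX; apply: commute_sym.
  move: e4 vv vu; move: (u ^+ 2) ((v ^+ n) ^+ 2) => U2 V2 e4 vv vu.
  by rewrite -mulgA vv mulgA e4 vu -mulgA.
have uvn : commute (u ^+ n) (v ^+ n) := unvn n.
split=> //; apply: (mulgI ((u ^+ n) ^+ 2)); rewrite -{2}E.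
have -> : (u ^+ n) ^+ 2 * (v ^+ n * v1 ^+ n) = u ^+ n * v ^+ n * (u ^+ n * v1 ^+ n).
  rewrite -[(u ^+ n) ^+ 2]/(u ^+ n * u ^+ n).
  by rewrite -!mulgA; congr (_ * _); rewrite !mulgA uvn.
rewrite e2 e3 -[u ^+ 2]/(u * u) -vv1 !mulgA -(mulgA u v u) -uv !mulgA.
have uuv : commute (u * u) (v * v1).
  by apply: commuteM; apply: commute_sym; apply: commuteM; apply: commute_sym.
by rewrite -(mulgA _ v v1) uuv !mulgA.
Qed.

Section OneSided.

Variables (gT : finGroupType) (H : {group gT}) (a b c w : gT) (x y i j : nat).
Hypothesis ab2 : a * b * (a * b) = 1.
Hypothesis bc2 : b * c * (b * c) = 1.
Hypothesis abc2 : a * b * c * (a * b * c) = 1.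
Hypothesis wa : w * a = a^-1 * w.
Hypothesis wb : w * b = b^-1 * w.
Hypothesis bH : b \in H.
Hypothesis cH : c \in H.
Hypothesis aH : forall z, z \in <[a]> -> z \in H -> z = 1.
Hypothesis Hbc : forall z, z \in H -> exists m n, z = b ^+ m * c ^+ n.
Hypothesis bVa : b^-1 * a = a ^+ x * b ^+ y.
Hypothesis cVb : c^-1 * b = b ^+ i * c ^+ j.

(* [Q] is [b ^ (y - 1)]. Since [w] inverts [a] and [b], both [P] and [Q] are central in
   [<a, b>]. The abbreviations are variables with equations so that rewriting cannot
   unfold them. *)
Variables (l : nat) (P Q R a2 t T : gT).
Hypothesis defl : l = (y + #[b].-1)%N.
Hypothesis defP : P = a ^+ x.+1.
Hypothesis defQ : Q = b ^+ l.
Hypothesis defR : R = P * Q.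
Hypothesis defa2 : a2 = a * a.
Hypothesis deft : t = a * b.
Hypothesis defT : T = b^-1 * a2^-1.

Lemma ba : b * a = a^-1 * b^-1.
Proof. exact: involutive_mulC ab2. Qed.

Lemma ab : a * b = b^-1 * a^-1.
Proof. exact: involutive_mul ab2. Qed.

Lemma cb : c * b = b^-1 * c^-1.
Proof. exact: involutive_mulC bc2. Qed.

Lemma bc : b * c = c^-1 * b^-1.
Proof. exact: involutive_mul bc2. Qed.

Lemma QE : Q = b ^+ y * b^-1.
Proof. by rewrite defQ defl expgD invg_expg. Qed.

(** Conjugation by [w] inverts each power in [bVa], and taking inverses then reverses the factors.
    This is the place where the regularity of the 3-faces enters. *)
Lemma aVb : a * b^-1 = b ^+ y * a ^+ x.
Proof.
apply: invg_inj; rewrite !invgM invgK.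
have := congr1 (fun z => w * z) bVa.
rewrite (intertwineM (intertwineV wb) wa) invgK.
rewrite (intertwineM (intertwineX x wa) (intertwineX y wb)) !expgVn.
exact: mulIg.
Qed.

(** By [bVa] and then [aVb], [b^-1 a a^x = a^x b^y a^x = a^x a b^-1]. *)
Lemma Pb : commute P b.
Proof.
rewrite -[b]invgK; apply: commuteV; rewrite /commute defP.
by rewrite {2}expgS [RHS]mulgA bVa -mulgA -aVb mulgA -expgSr.
Qed.

Lemma Qa : commute Q a.
Proof.
rewrite /commute {1}QE -mulgA bVa QE.
have -> : b ^+ y * b^-1 = b^-1 * b ^+ y.
  by apply: commuteV; apply: commute_sym; apply: commuteX.
by rewrite !mulgA aVb.
Qed.

Lemma Qb : commute Q b.
Proof. by rewrite defQ; apply: commute_sym; apply: commuteX. Qed.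

Lemma PQ : commute P Q.
Proof. by rewrite defQ; apply: commuteX; apply: Pb. Qed.

Lemma Pa : commute P a.
Proof. by rewrite defP; apply: commute_sym; apply: commuteX. Qed.

Lemma Ra : commute R a.
Proof. by rewrite defR; apply: commute_sym; apply: commuteM; apply: commute_sym; [exact: Pa | exact: Qa]. Qed.

Lemma Rb : commute R b.
Proof. by rewrite defR; apply: commute_sym; apply: commuteM; apply: commute_sym; [exact: Pb | exact: Qb]. Qed.

Lemma Qa2 : commute Q a2.
Proof. by rewrite defa2; apply: commuteM; apply: Qa. Qed.

Lemma Ra2 : commute R a2.
Proof. by rewrite defa2; apply: commuteM; apply: Ra. Qed.

Lemma ba2 : b * a2 = a2^-1 * R * b.
Proof.
have -> : b * a2 = a^-1 * (b^-1 * a) by rewrite defa2 mulgA ba !gnorm.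
by rewrite bVa defR QE defP expgS defa2 !gnorm.
Qed.

Lemma b2a2 : commute (b * b) a2.
Proof.
have e : b * (a2^-1 * R) = (a2^-1 * R)^-1 * R * b.
  by rewrite (intertwineM (intertwineV ba2) (commute_sym Rb)).
rewrite /commute -mulgA ba2 mulgA e !gnorm; congr (_ * b * b).
by rewrite -[LHS]mulgA -Ra2 !gnorm.
Qed.

Lemma ca : c * a = a * b * (b * c).
Proof.
apply: (mulgI (a * b)); apply: (mulIg (b * c)); rewrite (mulgA (a * b) (a * b)) ab2 mul1g bc2.
by move: abc2; rewrite !gnorm.
Qed.

Lemma ua : b * c * a = a^-1 * (b * c).
Proof. by apply: (mulgI a); apply: (mulIg (b * c)); rewrite mulKVg bc2; move: abc2; rewrite !gnorm. Qed.

(** Conjugation by [a2] turns [c] into [R^-1 c]. Computing the conjugates of powers of [c] in a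
    second way is the source of the relations on [Q]. *)
Lemma ca2 : c * a2 = a2 * (R^-1 * c).
Proof.
have -> : c * a2 = b^-1 * a2^-1 * b * c.
  by rewrite defa2 mulgA ca -(mulgA (a * b)) ua ab !gnorm.
rewrite [RHS]mulgA; congr (_ * c); apply: (mulIg R); rewrite -[RHS]mulgA mulVg mulg1.
apply: (mulgI b); rewrite ba2 !gnorm.
by rewrite -[in LHS]mulgA -[in RHS]mulgA Rb.
Qed.

Lemma uP : b * c * P = P^-1 * (b * c).
Proof. by rewrite defP -expgVn; apply: intertwineX; apply: ua. Qed.

Lemma cP : c * P = P^-1 * c.
Proof.
apply: (mulgI b); rewrite mulgA uP !mulgA; congr (_ * _).
by apply: commute_sym; apply: commuteV; apply: commute_sym; apply: Pb.
Qed.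

Lemma tb : t * b = T * t.
Proof. by rewrite defT deft defa2 !gnorm ab. Qed.

Lemma tc : t * c = c^-1 * t.
Proof.
apply: (mulIg (t * c)); rewrite -(mulgA c^-1) (mulgA t t) deft ab2 mul1g mulVg.
exact: abc2.
Qed.

Lemma tQ : t * Q = Q * t.
Proof.
by rewrite deft; apply: commute_sym; apply: commuteM; [apply: Qa|apply: Qb].
Qed.

Lemma TT : T * T = (b * b)^-1 * R^-1.
Proof.
have e : a2^-1 * b^-1 = b^-1 * R^-1 * a2.
  by have /(congr1 invg) := ba2; rewrite !gnorm.
by rewrite defT -mulgA (mulgA a2^-1) e !gnorm.
Qed.

Lemma cj_a2 k : c ^+ k * a2 = a2 * (R^-1 * c) ^+ k.
Proof. by rewrite (intertwineX k (esym ca2)). Qed.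

Lemma QH : Q \in H.
Proof. by rewrite defQ groupX. Qed.

Lemma HnP : H \subset 'N(<[P]>).
Proof.
have nb : b \in 'N(<[P]>).
  by rewrite inE -cycleJ cycle_subG conjgE Pb mulKg cycle_id.
have nc : c \in 'N(<[P]>).
  by rewrite -groupV inE -cycleJ cycle_subG conjgE invgK mulgA cP mulgK groupV cycle_id.
by apply/subsetP => z /Hbc [m [n ->]]; rewrite groupM ?groupX.
Qed.

(* [modP z h] says that [z] is [h] up to the normal subgroup generated by [P];
   it replaces the central element [R] of [<a, b>] by its part [Q] in [H]. *)
Definition modP z h := h^-1 * z \in <[P]>.

Lemma modPM z1 z2 h1 h2 : h2 \in H -> modP z1 h1 -> modP z2 h2 -> modP (z1 * z2) (h1 * h2).
Proof.
move=> hH e1 e2; rewrite /modP.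
have -> : (h1 * h2)^-1 * (z1 * z2) = (h1^-1 * z1) ^ h2 * (h2^-1 * z2).
  by rewrite conjgE !gnorm.
by rewrite groupM // memJ_norm // (subsetP HnP).
Qed.

Lemma modPV z h : h \in H -> modP z h -> modP z^-1 h^-1.
Proof.
move=> hH e; rewrite /modP.
have -> : h^-1^-1 * z^-1 = ((h^-1 * z)^-1) ^ h^-1 by rewrite conjgE !gnorm.
by rewrite memJ_norm ?groupV // (subsetP HnP) // groupV.
Qed.

Lemma modP_refl z : modP z z.
Proof. by rewrite /modP mulVg group1. Qed.

Lemma modPX z h n : h \in H -> modP z h -> modP (z ^+ n) (h ^+ n).
Proof.
move=> hH e; elim: n => [|n IHn]; first exact: modP_refl.
by rewrite !expgS; apply: modPM => //; apply: groupX.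
Qed.

Lemma Pcyc_sub : {subset <[P]> <= <[a]>}.
Proof. by apply/subsetP; rewrite cycle_subG defP mem_cycle. Qed.

(** [<P>] lies in [<a>], so it meets [H] trivially. Identities that carry [R] become identities
    inside [H] by this lemma. *)
Lemma modP_inj z h k : h \in H -> k \in H -> modP z h -> modP z k -> h = k.
Proof.
move=> hH kH eh ek; apply/eqP; rewrite eq_mulVg1; apply/eqP; apply: aH.
  apply: Pcyc_sub; have -> : h^-1 * k = h^-1 * z * (k^-1 * z)^-1 by rewrite !gnorm.
  by rewrite groupM ?groupV.
by rewrite groupM ?groupV.
Qed.

Lemma modPR : modP R Q.
Proof. by rewrite /modP defR PQ mulKg cycle_id. Qed.

(** A power of [P] commutes with [b], so [ba2] would give [R = a2 a2], and [Q] would be a power of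
    [a] lying in [H]. *)
Lemma a2P : a2 \in <[P]> -> Q = 1.
Proof.
move=> /cycleP [k ek].
have a2b : commute a2 b by rewrite ek; apply: commute_sym; apply: commuteX; apply: commute_sym; apply: Pb.
have e : R = a2 * a2.
  have := ba2; rewrite -a2b => /mulIg /(congr1 (mulg a2)).
  by rewrite mulKVg.
apply: aH QH; have -> : Q = P^-1 * (a2 * a2) by rewrite -e defR mulKg.
rewrite defP defa2 groupM ?groupV ?mem_cycle // !groupM ?cycle_id //.
Qed.

Variable S : gT.
Hypothesis defS : S = (b * b)^-1 * Q^-1.

Lemma SH : S \in H.
Proof. by rewrite defS groupM ?groupV ?groupM ?QH. Qed.

Lemma modPT n : modP (T ^+ (2 * n)) (S ^+ n).
Proof.
rewrite expgM; apply: modPX; first exact: SH.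
rewrite [T ^+ 2]TT defS; apply: modPM; rewrite ?groupV ?QH //; first exact: modP_refl.
by apply: modPV; [apply: QH | apply: modPR].
Qed.

Lemma SX n : S ^+ n = (b ^+ (2 * n))^-1 * (Q ^+ n)^-1.
Proof.
rewrite defS expgMn; first by rewrite !expgVn expgM.
apply: commuteV; apply: commute_sym; apply: commuteV.
by apply: commuteM; apply: Qb.
Qed.

Lemma modP_split z h k e :
  h \in H -> k \in H -> e \in <[a]> -> modP z h -> k * e = z -> h = k /\ e \in <[P]>.
Proof.
move=> hH kH ea ez kez.
have e1 : h^-1 * k = h^-1 * z * e^-1 by rewrite -kez !gnorm.
have e2 : h^-1 * k = 1.
  by apply: aH; [rewrite e1 groupM ?groupV // Pcyc_sub | rewrite groupM ?groupV].
have hk : h = k by apply/eqP; rewrite eq_mulVg1 e2.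
by split=> //; move: ez; rewrite /modP -kez hk mulKg.
Qed.

Lemma a2a : a2 \in <[a]>.
Proof. by rewrite defa2 groupM ?cycle_id. Qed.

(** [T^(2n+1) a2 = T^(2n) b^-1] is congruent to an element of [H], so [a2] is a power of [P]. *)
Lemma T_odd n : T ^+ (2 * n).+1 \in H -> Q = 1.
Proof.
move=> TH.
have e : modP (T ^+ (2 * n) * b^-1) (S ^+ n * b^-1).
  by apply: modPM; [rewrite groupV | exact: modPT | exact: modP_refl].
have [||||_ /a2P //] := modP_split (k := T ^+ (2 * n).+1) (e := a2) _ _ _ e.
- by rewrite groupM ?groupV // groupX // SH.
- by [].
- exact: a2a.
- by rewrite expgSr defT !gnorm.
Qed.

Lemma t_relation : c * T = T ^+ i * (c ^+ j)^-1.
Proof.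
have := congr1 (mulg t) cVb.
rewrite (intertwineM (intertwineV tc) tb) invgK.
by rewrite (intertwineM (intertwineX i tb) (intertwineX j tc)) expgVn => /mulIg.
Qed.

(** For even [i] the right side of [t_relation] is congruent to an element of [H], while the left
    side is [c b^-1] times [a2^-1]. The factor from [<a>] forces [Q = 1], and the parts in [H] give
    the inverse of the claim. *)
Lemma even_case n : i = (2 * n)%N -> b * c^-1 = c ^+ j * b ^+ i.
Proof.
move=> ei.
have e : modP (T ^+ i * (c ^+ j)^-1) (S ^+ n * (c ^+ j)^-1).
  by rewrite ei; apply: modPM; [rewrite groupV groupX | exact: modPT | exact: modP_refl].
have [||||eH] := modP_split (k := c * b^-1) (e := a2^-1) _ _ _ e.
- by rewrite groupM ?groupV ?groupX // SH.
- by rewrite groupM ?groupV.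
- by rewrite groupV a2a.
- by rewrite -t_relation defT !gnorm.
rewrite groupV => /a2P Q1.
move: eH; rewrite SX Q1 expg1n invg1 mulg1 -ei => /(congr1 invg).
by rewrite !gnorm.
Qed.

(** * Odd exponent [i]: controlling the conjugates of [Q] *)

Section OddCase.

Variables (n j' : nat).
Hypothesis odd_i : i = (2 * n).+1.
Hypothesis pos_j : j = j'.+1.
Variable Z : gT.
Hypothesis defZ : Z = c ^+ j'.

Lemma biE : b ^+ i = (b * b) ^+ n * b.
Proof. by rewrite odd_i expgSr expgM. Qed.

Lemma cjE : c ^+ j = Z * c.
Proof. by rewrite pos_j defZ expgSr. Qed.

Lemma cjE' : c ^+ j = c * Z.
Proof. by rewrite pos_j defZ expgS. Qed.

Lemma b2Xa2 k : commute ((b * b) ^+ k) a2.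
Proof. by apply: commute_sym; apply: commuteX; apply: commute_sym; apply: b2a2. Qed.

(** [c^-1 b = b c b^2] inverts [a2], because [b c] does and [b^2] commutes with [a2]. Removing
    [b^i], whose action on [a2] is that of [b] as [i] is odd, leaves the action of [c^j]. *)
Lemma cja2 : c ^+ j * a2 = a2 * (R^-1 * c ^+ j).
Proof.
have ua2 : b * c * a2 = a2^-1 * (b * c).
  by rewrite defa2 (intertwineM ua ua) !gnorm.
have e1 : b ^+ i * c ^+ j * a2 = a2^-1 * (b ^+ i * c ^+ j).
  have e : c^-1 * b = b * c * (b * b) by rewrite bc !gnorm.
  by rewrite -cVb e -mulgA b2a2 mulgA ua2 !mulgA.
have e2 : a2^-1 * b ^+ i = b ^+ i * (a2 * R^-1).
  rewrite biE -[RHS]mulgA (mulgA b) ba2.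
  have -> : a2^-1 * R * b * R^-1 = a2^-1 * b.
    by rewrite -[a2^-1 * R * b]mulgA Rb !gnorm.
  have := intertwineV (b2Xa2 n) => e3.
  by rewrite !mulgA e3.
apply: (mulgI (b ^+ i)); rewrite mulgA e1 mulgA e2 !gnorm //.
Qed.

(** The conjugate of [c^j] by [a2] is [(R^-1 c)^j] by [cj_a2] and [R^-1 c^j] by [cja2]. Read in [H],
    this is the claim after cancelling one factor [Q^-1 c]. *)
Lemma ZE : (Q^-1 * c) ^+ j' = Z.
Proof.
have e : (R^-1 * c) ^+ j = R^-1 * c ^+ j by apply: (mulgI a2); rewrite -cj_a2 cja2.
have eQ : modP (R^-1 * c) (Q^-1 * c).
  by apply: modPM => //; [apply: modPV; [exact: QH | exact: modPR] | exact: modP_refl].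
have H1 : Q^-1 * c \in H by rewrite groupM ?groupV ?QH.
have : (Q^-1 * c) ^+ j = Q^-1 * c ^+ j.
  apply: (@modP_inj ((R^-1 * c) ^+ j)); rewrite ?groupX //.
  - by rewrite groupM ?groupV ?groupX ?QH.
  - exact: modPX.
  rewrite e; apply: modPM; [exact: groupX | | exact: modP_refl].
  by apply: modPV; [exact: QH | exact: modPR].
by rewrite defZ pos_j [LHS]expgS expgS (mulgA Q^-1) => /mulgI.
Qed.

Lemma Zc : commute Z c.
Proof. by rewrite defZ; apply: commute_sym; apply: commuteX. Qed.

Lemma ZQ : commute Z Q.
Proof.
have e : commute Z (Q^-1 * c) by rewrite -ZE; apply: commute_sym; apply: commuteX.
have -> : Q = ((Q^-1 * c) * c^-1)^-1 by rewrite !gnorm.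
by apply: commuteV; apply: commuteM => //; apply: commuteV; apply: Zc.
Qed.

(* For [Q = 1] this is the mirror image of [cVb]; the rest of the section controls [Q]. *)
Lemma mirror : b * c^-1 = Q^-1 * c ^+ j * Q ^+ n * b ^+ i.
Proof.
have e1 : a2^-1 * (c ^+ j)^-1 = (c ^+ j)^-1 * R * a2^-1.
  by have /(congr1 invg) := cja2; rewrite !gnorm.
have e2 : c * b^-1 = T ^+ (2 * n) * (b^-1 * ((c ^+ j)^-1 * R)).
  have := t_relation; rewrite odd_i expgSr {1 3}defT -!mulgA e1 !mulgA.
  exact: mulIg.
have e3 : c * b^-1 = S ^+ n * (b^-1 * ((c ^+ j)^-1 * Q)).
  apply: (@modP_inj (c * b^-1)); rewrite ?groupM ?groupV ?groupX ?QH //.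
  - exact: SH.
  - exact: modP_refl.
  rewrite e2; apply: modPM; rewrite ?groupM ?groupV ?groupX ?QH //.
    exact: modPT.
  apply: modPM; rewrite ?groupM ?groupV ?groupX ?QH //; first exact: modP_refl.
  by apply: modPM; [exact: QH | exact: modP_refl | exact: modPR].
have := congr1 invg e3; rewrite SX !gnorm => ->.
rewrite -!mulgA; congr (_ * (_ * _)).
have e4 : b * Q ^+ n = Q ^+ n * b by apply: commuteX; apply: commute_sym; apply: Qb.
by rewrite mulgA e4 -mulgA odd_i expgS.
Qed.

Hypothesis nQ : Q <> 1.
Variables (h f g : nat).
Hypothesis even_l : l = (2 * h)%N.
Variables q q1 V : gT.
Hypothesis defq : q = c * Q * c^-1.
Hypothesis defq1 : q1 = c^-1 * Q * c.
Hypothesis defV : V = c ^+ g.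
Hypothesis qE : q = b ^+ f * V.

Lemma Tl : T ^+ l = Q.
Proof. by apply: (mulIg t); rewrite -tQ defQ (intertwineX l tb). Qed.

(** [Q = T^(2h)] is congruent to [S^h = b^(-l) Q^(-h) = Q^(-1-h)], and both ends lie in [H]. *)
Lemma Qh2 : Q ^+ h.+2 = 1.
Proof.
have e : S ^+ h = Q.
  apply: (@modP_inj Q); rewrite ?groupX ?SH ?QH //; last exact: modP_refl.
  by rewrite -{1}Tl even_l; apply: modPT.
move: e; rewrite SX -even_l -defQ => e.
by rewrite expgS expgSr -{1}e !gnorm.
Qed.

Lemma tq : t * q = q1 * t.
Proof. by rewrite defq defq1 (intertwineM (intertwineM tc tQ) (intertwineV tc)) invgK. Qed.

Lemma q1H : q1 \in H.
Proof. by rewrite defq1 !groupM ?groupV ?QH. Qed.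

(** Conjugation by [t] exchanges [q] and [q1], sends [b] to [T] and inverts [c], so this is the
    image of [qE]. It puts [T^f] into [H], which makes [f] even by [T_odd]. *)
Lemma q1E : q1 = T ^+ f * V^-1.
Proof.
apply: (mulIg t); rewrite -tq qE defV (intertwineM (intertwineX f tb) (intertwineX g tc)).
by rewrite expgVn.
Qed.

Lemma TfE : T ^+ f = q1 * V.
Proof. by rewrite q1E mulgKV. Qed.

Lemma TfH : T ^+ f \in H.
Proof. by rewrite TfE groupM ?q1H // defV groupX. Qed.

Lemma f_even : exists m, f = (2 * m)%N.
Proof.
case: (boolP (odd f)) => of_; last by exists f./2; rewrite mul2n even_halfK.
case: nQ; apply: (@T_odd f./2); rewrite mul2n -add1n -[1%N]/(nat_of_bool true) -of_ odd_double_half.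
exact: TfH.
Qed.

Lemma Tfb : commute (T ^+ f) b.
Proof.
have [m em] := f_even.
have -> : T ^+ f = S ^+ m.
  apply: (@modP_inj (T ^+ f)); rewrite ?TfH ?groupX ?SH //; first exact: modP_refl.
  by rewrite em; apply: modPT.
rewrite defS.
apply: commute_sym; apply: commuteX; apply: commuteM; apply: commuteV.
  exact: commuteM.
by apply: commute_sym; apply: Qb.
Qed.

Lemma Vc : commute V c.
Proof. by rewrite defV; apply: commute_sym; apply: commuteX. Qed.

Lemma bfQ : commute (b ^+ f) Q.
Proof. by apply: commute_sym; apply: commuteX; apply: Qb. Qed.

(* Conjugating [q = b^f V] by [a2] gives [(c Q^-1)^g = c^g]. *)
Lemma VQ : commute V Q.
Proof.
have [m em] := f_even.
have bfa2 : commute (b ^+ f) a2 by rewrite em expgM; apply: b2Xa2.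
have cVa2 : c^-1 * a2 = a2 * (R^-1 * c)^-1.
  by have := intertwineV (esym ca2) => ->.
have e1 : b ^+ f * (R^-1 * c) ^+ g = R^-1 * c * Q * (R^-1 * c)^-1.
  apply: (mulgI a2); rewrite mulgA -bfa2 -mulgA -cj_a2 mulgA -defV -qE defq.
  by rewrite -mulgA cVa2 -!mulgA (mulgA Q) Qa2 !mulgA ca2 !mulgA.
have eQ : modP (R^-1 * c) (Q^-1 * c).
  by apply: modPM => //; [apply: modPV; [exact: QH | exact: modPR] | exact: modP_refl].
have H1 : Q^-1 * c \in H by rewrite groupM ?groupV ?QH.
have e2 : b ^+ f * (Q^-1 * c) ^+ g = Q^-1 * c * Q * (Q^-1 * c)^-1.
  apply: (@modP_inj (b ^+ f * (R^-1 * c) ^+ g)); rewrite ?groupM ?groupX ?groupV ?QH //.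
    by apply: modPM; [exact: groupX | exact: modP_refl | exact: modPX].
  rewrite e1; apply: modPM; rewrite ?groupV //; last exact: modPV.
  by apply: modPM => //; [exact: QH | exact: modP_refl].
have e3 : (Q^-1 * c) ^+ g = Q^-1 * V * Q.
  apply: (mulgI (b ^+ f)); rewrite e2.
  have -> : Q^-1 * c * Q * (Q^-1 * c)^-1 = Q^-1 * q * Q by rewrite defq !gnorm.
  rewrite qE !mulgA; congr (_ * _ * _).
  by apply: commute_sym; apply: commuteV; apply: bfQ.
have e4 : (c * Q^-1) ^+ g = V.
  have e : Q * (Q^-1 * c) = c * Q^-1 * Q by rewrite !gnorm.
  by apply: (mulIg Q); rewrite -(intertwineX g e) e3 !gnorm.
have e : commute V (c * Q^-1) by rewrite -e4; apply: commute_sym; apply: commuteX.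
have -> : Q = (c^-1 * (c * Q^-1))^-1 by rewrite !gnorm.
by apply: commuteV; apply: commuteM => //; apply: commuteV; apply: Vc.
Qed.

Lemma commute_q z : commute z c -> commute z Q -> commute z q.
Proof. by move=> zc zQ; rewrite defq; apply: commuteM; [exact: commuteM | exact: commuteV]. Qed.

Lemma commute_q1 z : commute z c -> commute z Q -> commute z q1.
Proof. by move=> zc zQ; rewrite defq1; apply: commuteM => //; apply: commuteM => //; exact: commuteV. Qed.

Lemma Vq : commute V q. Proof. exact: commute_q Vc VQ. Qed.
Lemma Vq1 : commute V q1. Proof. exact: commute_q1 Vc VQ. Qed.
Lemma Zq : commute Z q. Proof. exact: commute_q Zc ZQ. Qed.
Lemma Qq : commute Q q.
Proof. by rewrite qE; apply: commuteM; [apply: commute_sym bfQ | apply: commute_sym VQ]. Qed.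

Lemma Qq1 : commute Q q1.
Proof.
rewrite q1E; apply: commuteM; last by apply: commuteV; apply: commute_sym VQ.
by apply: commute_sym; rewrite defQ; apply: commuteX; apply: Tfb.
Qed.

Lemma bfE : b ^+ f = q * V^-1.
Proof. by rewrite qE mulgK. Qed.

Lemma qq1 : commute q q1.
Proof.
have bV : commute (b ^+ f) V.
  by apply: commute_sym; rewrite bfE; apply: commuteM; [exact: Vq | exact: commuteV].
have TV : commute (T ^+ f) V.
  by apply: commute_sym; rewrite TfE; apply: commuteM; [exact: Vq1 | exact: commute_refl].
have Tb : commute (T ^+ f) (b ^+ f) by apply: commuteX; apply: Tfb.
have h1 := commuteM (commute_sym Tb) (commuteV bV).
have h2 := commuteM (commute_sym TV) (commuteV (commute_refl V)).
rewrite qE q1E; exact: commute_sym (commuteM (commute_sym h1) (commute_sym h2)).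
Qed.

Lemma bq : b * q = q1 * b.
Proof.
rewrite defq defq1 !mulgA bc -!mulgA; congr (_ * _); rewrite !mulgA.
have -> : b^-1 * Q = Q * b^-1 by apply: commute_sym; apply: commuteV; apply: Qb.
by rewrite -!mulgA cb.
Qed.

Lemma bV : b * V = V * q^-1 * q1 * b.
Proof.
apply: (mulgI (b ^+ f)); rewrite mulgA -expgSr expgS -mulgA -qE bq bfE.
by rewrite !gnorm.
Qed.

Lemma bq1 : b * q1 = q * b.
Proof.
have bT : b * T ^+ f = T ^+ f * b by rewrite Tfb.
rewrite {1}q1E (intertwineM bT (intertwineV bV)) TfE; congr (_ * _).
rewrite !gnorm -(mulgA q1) (commuteV Vq1) !gnorm.
by rewrite Vq !gnorm.
Qed.

Lemma bbq : commute (b * b) q.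
Proof. by rewrite /commute -mulgA bq mulgA bq1 mulgA. Qed.

Lemma bQ k : b * Q ^+ k = Q ^+ k * b.
Proof. by apply: commuteX; apply: commute_sym; apply: Qb. Qed.

Lemma qX k : c * Q ^+ k = q ^+ k * c.
Proof. by apply: intertwineX; rewrite defq !gnorm. Qed.

Variable Psi : gT.
Hypothesis defPsi : Psi = Q^-1 * q ^+ n.

(** [Psi] is the obstruction to [b] and [Z] commuting. It comes from [mirror] after eliminating
    [b^i] by [cVb]. *)
Lemma bZ : b * Z = Z * Psi * b.
Proof.
have e : b ^+ i = c^-1 * b * (c ^+ j)^-1 by rewrite cVb mulgK.
have := mirror; rewrite e => /(congr1 (mulg^~ (c ^+ j))).
rewrite {1}cjE' !gnorm => ->.
rewrite defPsi; have -> : q ^+ n = c * Q ^+ n * c^-1 by rewrite qX mulgK.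
rewrite cjE !mulgA (commuteV ZQ) //.
Qed.

Variable B : gT.
Hypothesis defB : B = b ^+ i.+1.

Lemma BE : B = (b * b) ^+ n.+1.
Proof. by rewrite defB odd_i -[(2 * n).+2]/(2 + 2 * n)%N -mulnS expgM. Qed.

Lemma b2aE : a * (R^-1 * (b * b)^-1) = b * b * a.
Proof.
have e : a * (b * b) = (b * b)^-1 * R^-1 * a.
  have := intertwineM tb tb; rewrite TT deft => h'.
  by apply: (mulIg b); rewrite -[RHS]mulgA -h' !mulgA.
have e' := congr1 (fun z => b * b * z * (b * b)^-1) e.
move: e'; rewrite !gnorm => e'.
have Ra' : R^-1 * a = a * R^-1 by apply: commute_sym; apply: commuteV; apply: commute_sym; apply: Ra.
by rewrite e' Ra' .
Qed.

Lemma ca_b : c * a = a * (b * c^-1 * b^-1).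
Proof. by rewrite ca bc !gnorm. Qed.

Lemma cBc : c * B * c = b * (c ^+ j.+1)^-1 * b^-1.
Proof.
have e : b ^+ i = c^-1 * b * (c ^+ j)^-1 by rewrite cVb mulgK.
by rewrite defB expgSr e !gnorm -(mulgA _ b c) bc expgS !gnorm.
Qed.

Lemma c2a : c * c * a = a * (B * c ^+ j.+1).
Proof.
have e : a * (b * c^-1 * b^-1 * (b * c^-1 * b^-1)) = c * c * a.
  by rewrite -(intertwineM (esym ca_b) (esym ca_b)).
rewrite -e defB expgS expgSr; congr (_ * _).
have e2 := congr1 (fun z => b * z * c) cVb.
by move: e2; rewrite !gnorm => <-; rewrite -(mulgA _ b c) bc !gnorm.
Qed.

(* Two evaluations of [c c] conjugated by [a2]. *)
Lemma cB : c * B = B * Q ^+ n * q^-1 * c.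
Proof.
have e1 : c * c * a2 = a2 * ((R^-1 * (b * b)^-1) ^+ n.+1 * (c * B * c)).
  have eB : B * a = a * (R^-1 * (b * b)^-1) ^+ n.+1.
    by rewrite (intertwineX n.+1 b2aE) BE.
  have ec : c ^+ j.+1 * a = a * (b * (c ^+ j.+1)^-1 * b^-1).
    have := intertwineX j.+1 (esym ca_b) => <-; congr (_ * _).
    have eb : b * c^-1 = (b * c^-1 * b^-1) * b by rewrite !gnorm.
    by have := intertwineX j.+1 eb; rewrite expgVn => ->; rewrite mulgK.
  rewrite defa2 mulgA c2a cBc -!mulgA ec (mulgA B) eB !mulgA //.
have e2 : (R^-1 * c) * (R^-1 * c) = (R^-1 * (b * b)^-1) ^+ n.+1 * (c * B * c).
  by apply: (mulgI a2); rewrite -e1; exact: esym (cj_a2 2).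
have RQ : modP R^-1 Q^-1 by apply: modPV; [exact: QH | exact: modPR].
have BH : B \in H by rewrite defB groupX.
have e3 : (Q^-1 * c) * (Q^-1 * c) = (Q^-1 * (b * b)^-1) ^+ n.+1 * (c * B * c).
  have QbH : Q^-1 * (b * b)^-1 \in H by rewrite groupM ?groupV ?groupM ?QH.
  have QcH : Q^-1 * c \in H by rewrite groupM ?groupV ?QH.
  apply: (modP_inj (groupM QcH QcH) (groupM (groupX _ QbH) (groupM (groupM cH BH) cH))).
    have RcQ : modP (R^-1 * c) (Q^-1 * c) by apply: modPM => //; exact: modP_refl.
    exact: (modPM QcH RcQ RcQ).
  rewrite e2; apply: modPM; rewrite ?groupM //; last exact: modP_refl.
  apply: modPX => //.
  by apply: modPM; rewrite ?groupV ?groupM //; exact: modP_refl.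
have QV : commute Q^-1 (b * b)^-1.
  apply: commuteV; apply: commute_sym; apply: commuteV; apply: commute_sym.
  by apply: commuteM; apply: Qb.
move: e3; rewrite expgMn // !expgVn -BE => e3.
have e4 := congr1 (fun z => B * Q ^+ n.+1 * z * c^-1) e3.
move: e4; rewrite !gnorm => <-.
by rewrite expgSr defq !gnorm.
Qed.

Lemma cVBc : c^-1 * B * c = B * Q ^+ n * q1^-1.
Proof.
have bB : b * B = B * b by rewrite defB -expgS expgSr.
have -> : c^-1 * B * c = b * (c * B * c^-1) * b^-1.
  have -> : b * (c * B * c^-1) * b^-1 = b * c * B * (c^-1 * b^-1) by rewrite !mulgA.
  have bVB : b^-1 * B = B * b^-1.
    by apply: commute_sym; apply: commuteV; apply: commute_sym.
  by rewrite -bc {1}bc -(mulgA c^-1 b^-1) bVB !gnorm.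
rewrite cB !gnorm.
by rewrite bB -!mulgA (mulgA b) bQ -!mulgA (mulgA b) (intertwineV bq) !gnorm.
Qed.

(** Conjugating [B] by [c] and then back must return [B], so the factors picked up in [cB] and
    [cVBc] cancel. *)
Lemma Qq1_n : Q ^+ n * q1 ^+ n = Q * q1.
Proof.
have e2 : c^-1 * q = Q * c^-1 by rewrite defq !gnorm.
have e3 : c^-1 * Q ^+ n = q1 ^+ n * c^-1 by apply: intertwineX; rewrite defq1 !gnorm.
have eB : B = c^-1 * (B * Q ^+ n * q^-1) * c by rewrite -(mulgA c^-1) -cB mulKg.
have : B = B * (Q ^+ n * q1^-1 * q1 ^+ n * Q^-1).
  rewrite {1}eB -!mulgA.
  have -> : c^-1 * (B * (Q ^+ n * (q^-1 * c))) = c^-1 * B * c * (c^-1 * Q ^+ n * q^-1 * c).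
    by rewrite !gnorm.
  by rewrite cVBc e3 -(mulgA (q1 ^+ n)) (intertwineV e2) !gnorm.
rewrite -{1}[B]mulg1 => /mulgI /(congr1 (fun z => q1 * z * Q)).
rewrite !gnorm => e.
have q1Q : commute q1 (Q ^+ n) by apply: commuteX; apply: commute_sym; apply: Qq1.
by move: e; rewrite q1Q !gnorm => <-; rewrite Qq1.
Qed.

Lemma Qq_n : Q ^+ n * q ^+ n = Q * q.
Proof.
have := congr1 (mulg b) Qq1_n.
rewrite (intertwineM (bQ n) (intertwineX n bq1)) (intertwineM (commute_sym Qb) bq1).
exact: mulIg.
Qed.

Variable G : gT.
Hypothesis defG : G = (b * b) ^+ n * Z.

Lemma cb2 : c * (b * b) = G * c.
Proof.
have e : b^-1 * (b * b) ^+ n = (b * b) ^+ n * b^-1.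
  apply: commuteX; apply: commute_sym; apply: commuteV; apply: commute_sym.
  exact: commuteM.
by rewrite mulgA cb -mulgA cVb biE cjE defG !mulgA e !gnorm.
Qed.

Lemma qG : q = G ^+ h.
Proof.
apply: (mulIg c); rewrite -(intertwineX h cb2) defq mulgKV defQ even_l expgM //.
Qed.

Lemma GPsi : commute G Psi.
Proof.
apply: commute_sym; rewrite defG; apply: commuteM.
  apply: commuteX; rewrite defPsi; apply: commute_sym; apply: commuteM.
    by apply: commuteV; apply: commute_sym; apply: commuteM; apply: Qb.
  by apply: commuteX; exact: bbq.
apply: commute_sym; rewrite defPsi; apply: commuteM; first by apply: commuteV; exact: ZQ.
by apply: commuteX; exact: Zq.
Qed.

(** Conjugating [q = G^h] by [b] gives [q1 = q Psi^h]. Moreover [Psi^(h+2) = 1], since [Q] and its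
    conjugate [q] commute and both satisfy this equation by [Qh2]. *)
Lemma q1_Psi : q1 * Psi ^+ 2 = q.
Proof.
have bG : b * G = G * Psi * b.
  have e : b * (b * b) ^+ n = (b * b) ^+ n * b by apply: commuteX; exact: commuteM.
  by rewrite defG (intertwineM e bZ) !mulgA.
have e : q1 = q * Psi ^+ h.
  apply: (mulIg b); rewrite -bq qG (intertwineX h bG) expgMn //; exact: GPsi.
have Psi1 : Psi ^+ h.+2 = 1.
  have QX : commute Q^-1 (q ^+ n).
    by apply: commuteX; apply: commute_sym; apply: commuteV; apply: commute_sym Qq.
  rewrite defPsi expgMn // expgVn Qh2 invg1 mul1g -expgM mulnC expgM.
  have -> : q ^+ h.+2 = 1; last exact: expg1n.
  by apply: (mulIg c); rewrite -qX Qh2 mulg1 mul1g.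
by rewrite e -mulgA -expgD addn2 Psi1 mulg1.
Qed.

Lemma qq1_products : q1 * q = (Q ^+ n) ^+ 2 /\ q ^+ n * q1 ^+ n = Q ^+ 2.
Proof.
apply: commuting_products; [exact: Qq | exact: Qq1 | exact: qq1 | | exact: Qq_n | exact: Qq1_n].
by rewrite -defPsi q1_Psi.
Qed.

(** Moving [b^2] past [Z] produces [Psi] times its conjugate by [b], which is
    [Q^-2 q^n q1^n = 1]. *)
Lemma b2Z : commute (b * b) Z.
Proof.
have [_ e] := qq1_products.
have bPsi : b * Psi = Q^-1 * q1 ^+ n * b.
  by rewrite defPsi (intertwineM (intertwineV (commute_sym Qb)) (intertwineX n bq)).
have Qqn : commute (Q^-1) (q ^+ n).
  by apply: commuteX; apply: commute_sym; apply: commuteV; apply: commute_sym; apply: Qq.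
have e' : Psi * (Q^-1 * q1 ^+ n) = 1.
  rewrite defPsi (mulgA _ Q^-1) -(mulgA Q^-1 (q ^+ n)) -Qqn -!mulgA e.
  by rewrite -[Q ^+ 2]/(Q * Q) !gnorm.
rewrite /commute -mulgA bZ mulgA (intertwineM bZ bPsi).
by rewrite -(mulgA Z) e' mulg1 mulgA.
Qed.

(** [qG] and [b2Z] give [q = Q^n Z^h]. Together with [q1 q = Q^(2n)] this turns the correction
    [q1^-1 Q^n] into [Z^h], a power of [c]. *)
Lemma odd_case_final : b * c^-1 = c ^+ j * Z ^+ h * b ^+ i.
Proof.
have [e _] := qq1_products.
have qZ : q = Q ^+ n * Z ^+ h.
  rewrite qG defG expgMn; last by apply: commute_sym; apply: commuteX; apply: commute_sym; apply: b2Z.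
  by rewrite -expgM mulnC expgM defQ even_l expgM.
have e1 : q1^-1 * Q ^+ n = Z ^+ h.
  apply: (mulgI q1); rewrite mulKVg; apply: (mulgI (Q ^+ n)); rewrite -[LHS]/((Q ^+ n) ^+ 2) -e qZ !mulgA.
  congr (_ * _); apply: commuteX; apply: commute_sym; apply: Qq1.
rewrite mirror -e1 !mulgA; congr (_ * _ * _).
have e2 : c * q1^-1 = Q^-1 * c by rewrite defq1 !gnorm.
have ZQV : Z * Q^-1 = Q^-1 * Z by apply: commuteV; apply: ZQ.
by rewrite cjE -(mulgA Z c q1^-1) e2 (mulgA Z) ZQV -mulgA.
Qed.

End OddCase.

End OneSided.

Lemma one_sided (gT : finGroupType) (H : {group gT}) (a b c w : gT) (x y i j : nat) :
    a * b * (a * b) = 1 -> b * c * (b * c) = 1 -> a * b * c * (a * b * c) = 1 ->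
    w * a = a^-1 * w -> w * b = b^-1 * w -> b \in H -> c \in H ->
    (forall z, z \in <[a]> -> z \in H -> z = 1) ->
    (forall z, z \in H -> exists m n, z = b ^+ m * c ^+ n) ->
    b^-1 * a = a ^+ x * b ^+ y -> c^-1 * b = b ^+ i * c ^+ j ->
  exists m, b * c^-1 = c ^+ m * b ^+ i.
Proof.
move=> ab2 bc2 abc2 wa wb bH cH aH Hbc bVa cVb0.
(* [j'.+1] is [j] plus the order of [c]: the exponent of [c] becomes positive without changing the
   power. *)
pose j' := (j + #[c].-1)%N.
have cVb : c^-1 * b = b ^+ i * c ^+ j'.+1.
  by rewrite -addnS prednK ?order_gt0 // expgD expg_order mulg1.
have ev n : i = (2 * n)%N -> exists m, b * c^-1 = c ^+ m * b ^+ i.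
  move=> ei; exists j'.+1.
  exact: (even_case ab2 bc2 abc2 wa wb bH cH aH Hbc bVa cVb erefl erefl erefl erefl erefl erefl erefl erefl ei).
case: (boolP (odd i)) => oi; last by apply: (ev i./2); rewrite mul2n even_halfK.
have oi' : i = (2 * i./2).+1 by rewrite mul2n -[LHS]odd_double_half oi.
pose l := (y + #[b].-1)%N; pose Q := b ^+ l.
have mir := mirror ab2 bc2 abc2 wa wb bH cH aH Hbc bVa cVb erefl erefl erefl erefl erefl erefl erefl erefl oi'.
case: (eqVneq Q 1) => [Q1 | /eqP nQ].
  by exists j'.+1; rewrite mir -/l -/Q Q1 invg1 mul1g expg1n mulg1.
have QH : Q \in H by rewrite groupX.
have [f [g qE]] : exists m n, c * Q * c^-1 = b ^+ m * c ^+ n.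
  by apply: Hbc; rewrite !groupM ?groupV.
have el : l = (2 * l./2)%N.
  case: (boolP (odd l)) => ol; last by rewrite mul2n even_halfK.
  (* [T^l = Q] lies in [H], so by [T_odd] an odd [l] would force [Q = 1]. *)
  case: nQ.
  have eT := Tl ab2 wa wb bVa erefl erefl erefl erefl erefl.
  have ol' : l = (2 * l./2).+1 by rewrite mul2n -[LHS]odd_double_half ol.
  apply: (T_odd ab2 bc2 abc2 wa wb bH aH Hbc bVa (erefl l) erefl (erefl Q) erefl erefl erefl erefl (n := l./2)).
  by rewrite -ol'; move: eT; rewrite -/l -/Q => ->.
exists (j'.+1 + j' * l./2)%N; rewrite expgD expgM.
exact: (odd_case_final ab2 bc2 abc2 wa wb bH cH aH Hbc bVa cVb (erefl l) erefl (erefl Q) erefl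
  erefl erefl erefl erefl oi' erefl erefl nQ el erefl erefl erefl qE erefl erefl erefl).
Qed.

End OneSided.

(** * Matching the exponents by duality *)

Section TwoSided.
Local Open Scope group_scope.
Variables (gT : finGroupType) (H : {group gT}) (a b c d : gT).
Hypothesis ab2 : a * b * (a * b) = 1.
Hypothesis bc2 : b * c * (b * c) = 1.
Hypothesis cd2 : c * d * (c * d) = 1.
Hypothesis abc2 : a * b * c * (a * b * c) = 1.
Hypothesis bcd2 : b * c * d * (b * c * d) = 1.
Hypothesis abcd2 : a * b * c * d * (a * b * c * d) = 1.

Lemma involution_intertwine (g z : gT) : g * g = 1 -> z * g * (z * g) = 1 -> g * z = z^-1 * g.
Proof.
move=> g2 h; apply: (mulgI z); apply: (mulIg g); rewrite mulKVg g2 -h !mulgA //.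
Qed.

Lemma bcd_inverts_a : b * c * d * a = a^-1 * (b * c * d).
Proof. by apply: involution_intertwine => //; move: abcd2; rewrite !mulgA. Qed.

Lemma bcd_inverts_b : b * c * d * b = b^-1 * (b * c * d).
Proof.
have e : c * d * b = b^-1 * (c * d).
  by apply: involution_intertwine => //; move: bcd2; rewrite !mulgA.
by rewrite -!mulgA (mulgA c) e !gnorm.
Qed.

Lemma abc_inverts_c : a * b * c * c = c^-1 * (a * b * c).
Proof.
have e : a * b * c = c^-1 * (a * b).
  apply: (mulIg (a * b * c)); rewrite abc2 -(mulgA c^-1) (mulgA (a * b) (a * b)) ab2 mul1g mulVg //.
by rewrite {1}e !mulgA.
Qed.

Lemma abc_inverts_d : a * b * c * d = d^-1 * (a * b * c).
Proof.
apply: (mulIg (a * b * c * d)); rewrite abcd2 -(mulgA d^-1) (mulgA (a * b * c) (a * b * c)) abc2 mul1g mulVg //.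
Qed.

Hypothesis bH : b \in H.
Hypothesis cH : c \in H.
Hypothesis aH : forall z, z \in <[a]> -> z \in H -> z = 1.
Hypothesis dH : forall z, z \in <[d]> -> z \in H -> z = 1.
Hypothesis bcI : forall z, z \in <[b]> -> z \in <[c]> -> z = 1.
Hypothesis Hbc : forall z, z \in H -> exists m n, z = b ^+ m * c ^+ n.
Hypothesis Kab : exists x y, b^-1 * a = a ^+ x * b ^+ y.
Hypothesis Kcd : exists x y, d * c^-1 = c ^+ y * d ^+ x.

(** The relation returned by the first use of [one_sided] is the input of the second, applied to
    [d^-1, c^-1, b^-1]. That returns [c^-1 b] as a power of [b] times [c^m]; comparison with [cVb]
    gives [c^m = c^j], because [<b>] and [<c>] meet trivially. *)
Lemma two_sided : exists i j, c^-1 * b = b ^+ i * c ^+ j /\ b * c^-1 = c ^+ j * b ^+ i.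
Proof.
have [i [j cVb]] : exists m n, c^-1 * b = b ^+ m * c ^+ n by apply: Hbc; rewrite groupM ?groupV.
have [x [y eK]] := Kab.
have [m em] := OneSided.one_sided ab2 bc2 abc2 bcd_inverts_a bcd_inverts_b bH cH aH Hbc eK cVb.
have [x' [y' eK']] := Kcd.
(* Exponents are natural numbers, so [c] and [b] are written as powers of the dual generators [c^-1]
   and [b^-1]. *)
pose I := (#[c^-1].-1 * m)%N; pose J := (#[b^-1].-1 * i)%N.
have cI : c^-1 ^+ I = c ^+ m by rewrite /I expgM -invg_expg invgK.
have bJ : b^-1 ^+ J = b ^+ i by rewrite /J expgM -invg_expg invgK.
have [m' em'] : exists m', c^-1 * b^-1^-1 = b^-1 ^+ m' * c^-1 ^+ I.
  apply: (@OneSided.one_sided _ H d^-1 c^-1 b^-1 (a * b * c) x' y' I J); rewrite ?groupV //.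
  - by rewrite -!invgM cd2 invg1.
  - by rewrite -!invgM bc2 invg1.
  - by rewrite -!invgM; move: bcd2; rewrite !mulgA => ->; rewrite invg1.
  - exact: intertwineV abc_inverts_d.
  - exact: intertwineV abc_inverts_c.
  - by move=> z; rewrite cycleV; exact: dH.
  - move=> z zH; have [k [k' e]] := Hbc (groupVr zH).
    by exists k', k; rewrite !expgVn -invgM -e invgK.
  - by apply: invg_inj; rewrite !invgM !invgK eK' !expgVn !invgK.
  by rewrite cI bJ invgK em.
exists i, j; split=> //; rewrite em; congr (_ * _).
move: em'; rewrite invgK cI cVb expgVn => em'.
apply/eqP; rewrite eq_mulgV1; apply/eqP; apply: bcI; last by rewrite groupM ?groupV ?mem_cycle.
have -> : c ^+ m * (c ^+ j)^-1 = b ^+ m' * b ^+ i.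
  by apply: (mulgI (b ^+ m')^-1); rewrite mulgA -em' !gnorm.
by rewrite groupM ?mem_cycle.
Qed.

End TwoSided.

(** * Products of cyclic subgroups that are closed under multiplication *)

Section ProductClosed.
Local Open Scope group_scope.

(* The two relations make [Y ^ (j - 1)] commute with [X]. *)
Lemma product_closed (gT : finGroupType) (X Y : gT) i j : Y * X = X^-1 * Y^-1 ->
    Y^-1 * X = X ^+ i * Y ^+ j -> X * Y^-1 = Y ^+ j * X ^+ i ->
  forall n, Y * X ^+ n \in <[X]> * <[Y]>.
Proof.
move=> YX e1 e2 n.
pose Z := Y ^+ j * Y^-1.
have ZX : commute Z X.
  have e3 : X ^+ i = Y^-1 * X * (Y ^+ j)^-1 by rewrite e1 mulgK.
  move: e2; rewrite e3 => /(congr1 (mulg^~ (Y ^+ j))).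
  rewrite /commute /Z !gnorm => <-.
  rewrite -!mulgA; congr (_ * _); apply: commute_sym.
  by apply: commuteV; apply: commute_sym; apply: commuteX.
pose U := X^-1 * X ^+ i.
have UX : U \in <[X]> by rewrite groupM ?groupV ?mem_cycle ?cycle_id.
have ZY : Z \in <[Y]> by rewrite groupM ?groupV ?mem_cycle ?cycle_id.
have UZ : commute U Z.
  have XZ := commute_sym ZX.
  apply: commute_sym; apply: commuteM; first exact: commuteV.
  exact: commuteX.
(* Even powers of [X] pass [Y] at the cost of powers of the commuting [U] and [Z]; one further [X]
   is absorbed by [YX]. *)
have sq : Y * (X * X) = U * Z * Y.
  by rewrite mulgA YX -mulgA e1 /U /Z !gnorm.
have sqk k : Y * (X * X) ^+ k = U ^+ k * Z ^+ k * Y by rewrite (intertwineX k sq) expgMn.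
rewrite -(odd_double_half n) addnC expgD -mul2n expgM [X ^+ 2]/(X * X) mulgA sqk.
case: (odd n); last by rewrite mulg1 -mulgA mem_mulg ?groupM ?groupX ?cycle_id.
rewrite expg1 -!mulgA YX (mulgA (Z ^+ _)).
have -> : Z ^+ n./2 * X^-1 = X^-1 * Z ^+ n./2.
  by apply: commuteV; apply: commute_sym; apply: commuteX; apply: commute_sym.
rewrite -(mulgA X^-1) (mulgA (U ^+ _)); apply: mem_mulg.
  by apply: groupM; [apply: groupX | rewrite groupV cycle_id].
by apply: groupM; [apply: groupX | rewrite groupV cycle_id].
Qed.

End ProductClosed.

Section FourFactors.
Local Open Scope group_scope.
Variables (gT : finGroupType) (A B C D : gT).
Hypothesis BA : forall n, B * A ^+ n \in <[A]> * <[B]>.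
Hypothesis CB : forall n, C * B ^+ n \in <[B]> * <[C]>.
Hypothesis DC : forall n, D * C ^+ n \in <[C]> * <[D]>.
Hypothesis CA : C * A = A * (B * B) * C.
Hypothesis DA : D * A = A * D.
Hypothesis DB : D * B = B * (C * C) * D.

Lemma left_closed (X Y z : gT) : (forall n, Y * X ^+ n \in <[X]> * <[Y]>) ->
  z \in <[X]> * <[Y]> -> (X * z \in <[X]> * <[Y]>) /\ (Y * z \in <[X]> * <[Y]>).
Proof.
move=> YX /mulsgP [s t sX tY ->]; split; first by rewrite mulgA mem_mulg ?groupM ?cycle_id.
have /cycleP [n ->] := sX; have /mulsgP [s' t' sX' tY' e] := YX n.
by rewrite mulgA e -mulgA mem_mulg ?groupM.
Qed.

Lemma power_closed (X Y : gT) : (forall n, Y * X ^+ n \in <[X]> * <[Y]>) ->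
  forall n, (X * (Y * Y)) ^+ n \in <[X]> * <[Y]>.
Proof.
move=> YX; elim=> [|n IHn]; first by apply/mulsgP; exists 1 1; rewrite ?group1 ?mulg1.
rewrite expgS -!mulgA.
by apply: (proj1 (left_closed YX _)); do 2!apply: (proj2 (left_closed YX _)).
Qed.

Let S := <[A]> * <[B]> * (<[C]> * <[D]>).

(** [C] moves past [A^k] leaving [(A B^2)^k] in [<A><B>], and [D] moves past [A^k B^k'] leaving
    [A^k (B C^2)^k']. What is left over thus stays within products of neighbouring factors. *)
Lemma four_factors_closed g z : g \in [set A; B; C; D] -> z \in S -> g * z \in S.
Proof.
move=> gABCD /mulsgP [s r sAB rCD ->].
have inS u : u \in <[A]> * <[B]> -> u * r \in S by move=> uAB; apply: mem_mulg.
have inS' u v : u \in <[A]> * <[B]> -> v \in <[B]> * <[C]> -> forall r', r' \in <[C]> * <[D]> -> u * (v * r') \in S.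
  move=> uAB /mulsgP [v1 v2 v1B v2C ->] r' /mulsgP [r1 r2 r1C r2D ->].
  have -> : u * (v1 * v2 * (r1 * r2)) = u * v1 * (v2 * r1 * r2) by rewrite !mulgA.
  apply: mem_mulg; last by rewrite mem_mulg ?groupM.
  by have /mulsgP [u1 u2 u1A u2B ->] := uAB; rewrite -mulgA mem_mulg ?groupM.
have /mulsgP [s1 s2 /cycleP [k ek] s2B es] := sAB; have /cycleP [k' ek'] := s2B.
move: gABCD; rewrite !inE -!orbA => /or4P [] /eqP ->.
- by rewrite mulgA; apply: inS; case: (left_closed BA sAB).
- by rewrite mulgA; apply: inS; case: (left_closed BA sAB).
- rewrite es ek ek'.
  have -> : C * (A ^+ k * B ^+ k' * r) = (A * (B * B)) ^+ k * (C * B ^+ k' * r).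
    by rewrite -!mulgA (mulgA C (A ^+ _)) (intertwineX k CA) -!mulgA.
  by apply: inS' => //; apply: power_closed.
rewrite es ek ek'.
have -> : D * (A ^+ k * B ^+ k' * r) = A ^+ k * ((B * (C * C)) ^+ k' * (D * r)).
  by rewrite -!mulgA (mulgA D (A ^+ _)) (intertwineX k DA) -!mulgA (mulgA D (B ^+ _)) (intertwineX k' DB) -!mulgA.
apply: inS'; first by apply/mulsgP; exists (A ^+ k) 1; rewrite ?mem_cycle ?group1 ?mulg1.
  exact: power_closed.
by case: (left_closed DC rCD).
Qed.

Lemma four_factors : <<[set A; B; C; D]>> \subset S.
Proof.
apply/subsetP => z /gen_prodgP [n [f fS ->]].
elim: n f fS => [|n IHn] f fS.
  by rewrite big_ord0; apply/mulsgP; exists 1 1; rewrite ?mulg1 //; apply/mulsgP; exists 1 1; rewrite ?group1 ?mulg1.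
by rewrite big_ord_recl; apply: four_factors_closed => //; apply: IHn.
Qed.

End FourFactors.

(** * The graph of the formal reflection *)

Section MirrorGroup.
Local Open Scope group_scope.
Variables (gT : finGroupType) (a b c d : gT) (i j : nat).
Hypothesis ab2 : a * b * (a * b) = 1.
Hypothesis bc2 : b * c * (b * c) = 1.
Hypothesis cd2 : c * d * (c * d) = 1.
Hypothesis abc2 : a * b * c * (a * b * c) = 1.
Hypothesis bcd2 : b * c * d * (b * c * d) = 1.
Hypothesis abcd2 : a * b * c * d * (a * b * c * d) = 1.
Hypothesis da : d * a = a * d.
Hypothesis baX : forall n, b * a ^+ n \in <[a]> * <[b]>.
Hypothesis dcX : forall n, d * c ^+ n \in <[c]> * <[d]>.
Hypothesis cVb : c^-1 * b = b ^+ i * c ^+ j.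
Hypothesis bcV : b * c^-1 = c ^+ j * b ^+ i.

(* Conjugation by the missing reflection [r2] sends [a, b, c, d] to the second
   components below. *)
Definition mirA : gT * gT := (a, b^-1 * a^-1 * b).
Definition mirB : gT * gT := (b, b^-1).
Definition mirC : gT * gT := (c, c^-1).
Definition mirD : gT * gT := (d, c * d^-1 * c^-1).
(** As a subgroup it is multiplicative by construction; that it is single-valued is the content of
    [mirror_one]. *)
Definition mirror_group := <<[set mirA; mirB; mirC; mirD]>>.

Lemma pairM (x y x' y' : gT) : (x, y) * (x', y') = (x * x', y * y') :> gT * gT.
Proof. by []. Qed.

Lemma pairV (x y : gT) : (x, y)^-1 = (x^-1, y^-1) :> gT * gT.
Proof. by []. Qed.

Lemma pairX (x y : gT) n : (x, y) ^+ n = (x ^+ n, y ^+ n) :> gT * gT.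
Proof. by elim: n => // n IHn; rewrite !expgS IHn. Qed.

(** The pairs [(z, z ^ g)] form a copy of the group, so product relations carry over to them. *)
Lemma pair_conj_mul (x y g : gT) : (forall n, y * x ^+ n \in <[x]> * <[y]>) ->
  forall n, (y, y ^ g) * (x, x ^ g) ^+ n \in <[(x, x ^ g)]> * <[(y, y ^ g)]>.
Proof.
move=> h n; have /mulsgP [u v /cycleP [k ->] /cycleP [l ->] e] := h n.
apply/mulsgP; exists ((x, x ^ g) ^+ k) ((y, y ^ g) ^+ l); rewrite ?mem_cycle //.
by rewrite !pairX !pairM e -!conjXg -!conjMg e.
Qed.

Lemma conj_inverts (g x : gT) : g * x = x^-1 * g -> x ^ g = x^-1.
Proof. by move=> e; rewrite -[x in x ^ g]invgK conjVg conjgE -e mulKg. Qed.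

Let B := mirB. Let A := mirA. Let C := mirC. Let D := mirD.

(** On [a] and [b] the reflection is an inner automorphism: [b c d] inverts both, and a further
    conjugation by [b] gives the chosen images. The same happens for [c] and [d], so only the pair
    [B, C] requires both [cVb] and [bcV]. *)
Lemma mirBA n : B * A ^+ n \in <[A]> * <[B]>.
Proof.
pose g := b * c * d * b.
have eA : A = (a, a ^ g) by rewrite conjgM (conj_inverts (bcd_inverts_a bcd2 abcd2)) conjgE mulgA.
have eB : B = (b, b ^ g).
  by rewrite conjgM (conj_inverts (bcd_inverts_b cd2 bcd2)) conjgE -(commuteV (commute_refl b)) mulKg.
rewrite eA eB; exact: pair_conj_mul.
Qed.

Lemma mirDC n : D * C ^+ n \in <[C]> * <[D]>.
Proof.
(* This is [a b], kept as [a b c], which inverts [c] and [d], followed by [c^-1]. *)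
pose g := a * b * c * c^-1.
have eC : C = (c, c ^ g).
  by rewrite conjgM (conj_inverts (abc_inverts_c ab2 abc2)) conjgE invgK mulKVg.
have eD : D = (d, d ^ g).
  by rewrite conjgM (conj_inverts (abc_inverts_d abc2 abcd2)) conjgE invgK mulgA.
rewrite eC eD; exact: pair_conj_mul.
Qed.

Lemma mirCB n : C * B ^+ n \in <[B]> * <[C]>.
Proof.
apply: (@product_closed _ _ _ i j).
- rewrite /C /B /mirC /mirB !pairV !pairM !invgK; congr (_, _); first exact: (involutive_mulC bc2).
  by rewrite (involutive_mul bc2).
- rewrite /C /B /mirC /mirB !pairV !pairX !pairM cVb !expgVn invgK; congr (_, _).
  by apply: invg_inj; rewrite !invgM !invgK bcV.
rewrite /C /B /mirC /mirB !pairV !pairX !pairM bcV !expgVn invgK; congr (_, _).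
by apply: invg_inj; rewrite !invgM !invgK cVb.
Qed.

Lemma bc_inverts_a : b * c * a = a^-1 * (b * c).
Proof. by apply: involution_intertwine => //; move: abc2; rewrite !mulgA. Qed.

Lemma cd_inverts_b : c * d * b = b^-1 * (c * d).
Proof. by apply: involution_intertwine => //; move: bcd2; rewrite !mulgA. Qed.

Lemma mirCA : C * A = A * (B * B) * C.
Proof.
rewrite /A /B /C /mirA /mirB /mirC !pairM; congr (_, _); first by rewrite (OneSided.ca ab2 bc2 abc2) !mulgA.
have e : c^-1 * b^-1 = b * c by rewrite (involutive_mul bc2).
rewrite !gnorm e.
have -> : b * c * a^-1 = a * (b * c) by rewrite (intertwineV bc_inverts_a) invgK.
have e2 : b^-1 * a^-1 = a * b by rewrite (involutive_mul ab2).
by rewrite e2 -!mulgA (involutive_mulC bc2) !gnorm.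
Qed.

Lemma mirDA : D * A = A * D.
Proof.
rewrite /A /D /mirA /mirD !pairM da; congr (_, _).
have -> : b^-1 * a^-1 * b = c * a * c^-1 by rewrite (OneSided.ca ab2 bc2 abc2) -(involutive_mul ab2) !gnorm.
have e : d^-1 * a = a * d^-1 by apply: commute_sym; apply: commuteV; exact: esym.
by rewrite !gnorm -(mulgA c) e !gnorm.
Qed.

Lemma mirDB : D * B = B * (C * C) * D.
Proof.
rewrite /B /C /D /mirB /mirC /mirD !pairM; congr (_, _).
  by apply: (mulgI c); rewrite mulgA cd_inverts_b !mulgA (involutive_mulC bc2) !gnorm.
have dc : d^-1 * c^-1 = c * d by apply: (mulgI (c * d)); rewrite cd2 !gnorm.
have vb : c * d * b^-1 = b * (c * d) by rewrite (intertwineV cd_inverts_b) invgK.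
by rewrite !gnorm -(mulgA c) -(mulgA _ d^-1 c^-1) dc -(mulgA c) vb !mulgA (involutive_mulC bc2) !gnorm.
Qed.

(** Applying [four_factors] to the inverse reverses the factors into the order used by
    [factorization]. *)
Lemma mirror_factors z : z \in mirror_group ->
  exists m n k l, z = D ^+ m * C ^+ n * B ^+ k * A ^+ l.
Proof.
rewrite -groupV => /(subsetP (four_factors mirBA mirCB mirDC mirCA mirDA mirDB)).
case/mulsgP => u v /mulsgP [u1 u2 u1A u2B ->] /mulsgP [v1 v2 v1C v2D ->] e.
have [m em] := cycleP _ _ (groupVr v2D); have [n en] := cycleP _ _ (groupVr v1C).
have [k ek] := cycleP _ _ (groupVr u2B); have [l el] := cycleP _ _ (groupVr u1A).
by exists m, n, k, l; rewrite -em -en -ek -el -[z]invgK e !invgM !mulgA.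
Qed.

Lemma mirror_group_gens : [/\ A \in mirror_group, B \in mirror_group,
  C \in mirror_group & D \in mirror_group].
Proof. by split; apply: mem_gen; rewrite !inE eqxx ?orbT. Qed.

(** The reflection is an involution: each generator with its components exchanged is a word in the
    generators. *)
Lemma mirror_group_swap g h : (g, h) \in mirror_group -> (h, g) \in mirror_group.
Proof.
have [AF BF CF DF] := mirror_group_gens.
pose sw (z : gT * gT) : gT * gT := (z.2, z.1).
suff h1 z : z \in mirror_group -> sw z \in mirror_group by move/h1.
case/gen_prodgP => n [f fS ->].
elim: n f fS => [|n IHn] f fS; first by rewrite big_ord0 (_ : sw 1 = 1) // group1.
rewrite big_ord_recl (_ : sw _ = sw (f ord0) * sw (\prod_(k < n) f (lift ord0 k))) //.
apply: groupM; last by apply: IHn.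
have := fS ord0; rewrite !inE -!orbA => /or4P [] /eqP ->; rewrite /sw /=.
- have -> : (b^-1 * a^-1 * b, a) = B^-1 * A^-1 * B.
    by rewrite /A /B !pairV !pairM; congr (_, _); rewrite !gnorm.
  by rewrite !groupM ?groupV.
- have -> : (b^-1, b) = B^-1 by rewrite /B !pairV invgK.
  by rewrite groupV.
- have -> : (c^-1, c) = C^-1 by rewrite /C !pairV invgK.
  by rewrite groupV.
have -> : (c * d^-1 * c^-1, d) = C * D^-1 * C^-1.
  by rewrite /C /D !pairV !pairM; congr (_, _); rewrite !gnorm.
by rewrite !groupM ?groupV.
Qed.

End MirrorGroup.

(* The boolean order hypotheses of the context would slow [lia] down considerably. *)
Ltac nlia :=
  repeat match goal with
  | H : ?P |- _ =>
    lazymatch P with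
    | is_true (leq _ _) => fail
    | is_true (leq _ _ && _) => fail
    | is_true (~~ (@eq_op ?t _ _)) => tryif unify (Equality.sort t) nat then fail else clear H
    | @eq ?t _ _ => tryif unify t nat then fail else clear H
    | ~ (@eq ?t _ _) => tryif unify t nat then fail else clear H
    | _ \/ _ => fail
    | nat => fail
    | _ => clear H
    end
  end; lia.

(** * Flags, rigidity and rotations *)

Section Polytope.
Variables (T : finType) (le : rel T) (rk : T -> int) (n : nat).
Hypothesis poly : is_polytope le rk n.

(* Ranks are shifted by one: [idx] runs from 0 (least face) to [n.+1]. *)
Definition idx (x : T) : nat := absz (rk x + 1)%R.

Lemma rk_idx x : rk x = ((idx x)%:Z - 1)%R.
Proof. by case: poly => [[_ _ _ /(_ x) [h _] _] _]; rewrite /idx; lia. Qed.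

Lemma idx_max x : idx x <= n.+1.
Proof. by case: poly => [[_ _ _ /(_ x) [h1 h2] _] _]; rewrite /idx; lia. Qed.

Lemma le_refl x : le x x.
Proof. by case: poly => [[[h _ _] _ _ _ _] _]. Qed.

Lemma le_trans y x z : le x y -> le y z -> le x z.
Proof. by case: poly => [[[_ _ h] _ _ _ _] _]; apply: h. Qed.

Lemma lt_idx x y : le x y -> x != y -> idx x < idx y.
Proof.
move=> xy nxy; case: poly => [[_ _ _ _ h] _].
by have := h x y; rewrite /Defs.ltP xy nxy => /(_ isT); rewrite !rk_idx; nlia.
Qed.

Lemma le_idx x y : le x y -> idx x <= idx y.
Proof. by have [->|nxy] := eqVneq x y => // xy; apply/ltnW/lt_idx. Qed.

Lemma le_idx_eq x y : le x y -> idx x = idx y -> x = y.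
Proof. by move=> xy e; apply/eqP; apply: contraT => /(lt_idx xy); rewrite e ltnn. Qed.

Lemma incident_le x y : incident le x y -> idx x <= idx y -> le x y.
Proof.
case/orP => // yx xy; suff -> : y = x by exact: le_refl.
by apply: le_idx_eq => //; apply/eqP; rewrite eqn_leq xy le_idx.
Qed.

Lemma incidentC x y : incident le x y = incident le y x.
Proof. by rewrite /incident orbC. Qed.

(** A flag as a function of the shifted rank. Values beyond [n.+1] are arbitrary, so flags are
    compared only up to that bound. *)
Definition flagfun (F : nat -> T) : Prop :=
  (forall k, k <= n.+1 -> idx (F k) = k) /\
  (forall i j, i <= j -> j <= n.+1 -> le (F i) (F j)).

Definition flagset (F : nat -> T) : {set T} := [set F i | i : 'I_n.+2].

Lemma chainP (C : {set T}) :
  reflect (forall x y, x \in C -> y \in C -> incident le x y) (is_chain le C).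
Proof.
apply: (iffP forallP) => [h x y xC yC | h x].
  by have /implyP/(_ xC)/forallP/(_ y)/implyP := h x; apply.
by apply/implyP => xC; apply/forallP => y; apply/implyP; apply: h.
Qed.

Lemma mem_flagset F x : reflect (exists2 k, k <= n.+1 & x = F k) (x \in flagset F).
Proof.
apply: (iffP imsetP) => [[i _ ->] | [k kn ->]]; first by exists i => //; rewrite -ltnS.
by exists (Ordinal (kn : k < n.+2)).
Qed.

Lemma flagset_flag F : flagfun F -> flagset F \in flags le.
Proof.
move=> [Fi Fl]; rewrite inE; apply/andP; split.
  apply/chainP => _ _ /mem_flagset [i iN ->] /mem_flagset [j jN ->].
  by apply/orP; case: (leqP i j) => ij; [left | right]; apply: Fl => //; apply: ltnW.
apply/forallP => z; apply/implyP => zF; apply/existsP; exists (F (idx z)).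
apply/andP; split; first by apply/mem_flagset; exists (idx z); rewrite ?idx_max.
apply: contra zF => iz; apply/mem_flagset; exists (idx z); rewrite ?idx_max //.
by apply: esym; apply: le_idx_eq; rewrite ?Fi ?idx_max //; apply: incident_le; rewrite ?Fi ?idx_max.
Qed.

(** The shifted rank is injective on a chain, and a flag has as many faces as there are ranks. *)
Lemma flag_cover C : is_flag le C -> forall k, k <= n.+1 -> exists2 x, x \in C & idx x = k.
Proof.
move=> fC k kn; have /andP [/chainP chC _] := fC.
have cardC : #|C| = n.+2 by case: poly => [_ [h _ _]]; exact: h.
pose r x : 'I_n.+2 := inord (idx x).
have rE x : r x = idx x :> nat by rewrite inordK // ltnS idx_max.
have injr : {in C &, injective r}.
  move=> x y xC yC /(congr1 (@nat_of_ord _)); rewrite !rE => e.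
  by apply: le_idx_eq => //; apply: incident_le; rewrite ?e //; apply: chC.
have /eqP imr : r @: C == setT.
  by rewrite eqEcard subsetT cardsT card_ord (card_in_imset injr) cardC leqnn.
have : inord k \in r @: C by rewrite imr inE.
by case/imsetP => x xC /(congr1 (@nat_of_ord _)); rewrite rE inordK // => e; exists x.
Qed.

Lemma chain_flag C : is_chain le C ->
  exists F, flagfun F /\ forall x, x \in C -> F (idx x) = x.
Proof.
move=> chC; have [D /maxsetP [chD maxD] CD] := maxset_exists chC.
have fD : is_flag le D.
  rewrite /is_flag chD; apply/forallP => z; apply/implyP => zD.
  apply: contraT; rewrite negb_exists => /forallP h.
  have hz x : x \in D -> incident le x z.
    by move=> xD; have := h x; rewrite xD negbK.
  suff : z |: D = D by move=> e; move: zD; rewrite -e setU11.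
  apply: maxD; last exact: subsetUr.
  apply/chainP => x y /setU1P [->|xD] /setU1P [->|yD].
  - by rewrite /incident le_refl.
  - by rewrite incidentC hz.
  - exact: hz.
  exact: (elimT (chainP _) chD).
have cov := flag_cover fD.
have [x0 _ _] := cov 0 (leq0n _).
pose F k := odflt x0 [pick x in D | idx x == k].
have FP k : k <= n.+1 -> F k \in D /\ idx (F k) = k.
  move=> /cov [x xD xk]; rewrite /F; case: pickP => [y /andP [yD /eqP yk] // | /(_ x)].
  by rewrite xD xk eqxx.
have inc x y : x \in D -> y \in D -> idx x <= idx y -> le x y.
  by move=> xD yD; apply: incident_le; apply: (elimT (chainP _) chD).
exists F; split; first split.
- by move=> k /FP [].
- move=> i j ij jn; have [iD ik] := FP i (leq_trans ij jn); have [jD jk] := FP j jn.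
  by apply: inc; rewrite ?ik ?jk.
move=> x /(subsetP CD) xD; have [fxD fxi] := FP _ (idx_max x).
by apply: le_idx_eq => //; apply: inc => //; rewrite fxi.
Qed.

Section Automorphisms.
Variable f : {perm T}.
Hypothesis autf : is_aut le f.

Lemma aut_le x y : le (f x) (f y) = le x y.
Proof. by have /forallP/(_ x)/forallP/(_ y)/eqP := autf. Qed.

(** [f] sends a flag through [x] to faces of strictly increasing shifted rank. Counting from the
    bottom ([lo]) and from the top ([hi]) leaves only one possible value. *)
Lemma aut_idx x : idx (f x) = idx x.
Proof.
have chx : is_chain le [set x].
  by apply/chainP => y z /set1P -> /set1P ->; rewrite /incident le_refl.
have [F [[Fi Fl] /(_ x (set11 x)) Fx]] := chain_flag chx.
have up k : k <= n -> idx (f (F k)) < idx (f (F k.+1)).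
  move=> kn; apply: lt_idx; first by rewrite aut_le Fl.
  apply/eqP => /perm_inj e; have := Fi k ltac:(nlia); have := Fi k.+1 ltac:(nlia).
  rewrite e; nlia.
have lo k : k <= n.+1 -> k <= idx (f (F k)).
  elim: k => // k IHk kn; apply: leq_ltn_trans (up k kn); apply: IHk; nlia.
have hi m : m <= n.+1 -> idx (f (F (n.+1 - m))) + m <= n.+1.
  elim: m => [|m IHm] mn; first by rewrite addn0 idx_max.
  have := up (n.+1 - m.+1) ltac:(nlia).
  have -> : (n.+1 - m.+1).+1 = n.+1 - m by nlia.
  have := IHm ltac:(nlia); nlia.
have := lo _ (idx_max x); have := hi (n.+1 - idx x) (leq_subr _ _).
rewrite subKn ?idx_max // Fx; have := idx_max x; nlia.
Qed.

End Automorphisms.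

Lemma aut1 : is_aut le 1%g.
Proof. by apply/forallP => x; apply/forallP => y; rewrite !perm1. Qed.

Lemma autM f g : is_aut le f -> is_aut le g -> is_aut le (f * g)%g.
Proof. by move=> hf hg; apply/forallP => x; apply/forallP => y; rewrite !permM !aut_le. Qed.

Lemma autV f : is_aut le f -> is_aut le f^-1%g.
Proof.
move=> hf; apply/forallP => x; apply/forallP => y.
by rewrite -(aut_le hf) !permKV.
Qed.

Lemma diamond x z : le x z -> idx z = (idx x).+2 -> forall y y' y'',
    le x y -> le y z -> idx y = (idx x).+1 -> le x y' -> le y' z -> idx y' = (idx x).+1 ->
    le x y'' -> le y'' z -> idx y'' = (idx x).+1 -> y != y' -> y'' != y -> y'' = y'.
Proof.
move=> xz ez y y' y'' xy yz ey xy' y'z ey' xy'' y''z ey'' ny ny'.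
have /eqP/cards2P [u [v [_ e]]] : #|open_section le x z| = 2.
  by case: poly => [_ [_ h _]]; apply: h => //; rewrite !rk_idx ez; nlia.
have mem t : le x t -> le t z -> idx t = (idx x).+1 -> t = u \/ t = v.
  move=> xt tz et; have : t \in open_section le x z.
    rewrite inE /Defs.ltP xt tz /=; apply/andP; split; apply/eqP => h.
      by move: et; rewrite h; nlia.
    by move: et; rewrite h ez; nlia.
  by rewrite e => /set2P.
move: ny ny'; case: (mem y) => // ->; case: (mem y') => // ->; case: (mem y'') => // ->;
  by rewrite ?eqxx.
Qed.

Lemma diamond_other x y z : le x y -> le y z -> idx y = (idx x).+1 -> idx z = (idx x).+2 ->
  exists y', [/\ le x y', le y' z, idx y' = (idx x).+1 & y' != y].
Proof.
move=> xy yz ey ez; have xz := le_trans xy yz.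
have /eqP/cards2P [u [v [nuv e]]] : #|open_section le x z| = 2.
  by case: poly => [_ [_ h _]]; apply: h => //; rewrite !rk_idx ez; nlia.
have mem t : t \in open_section le x z -> [/\ le x t, le t z & idx t = (idx x).+1].
  rewrite inE /Defs.ltP => /andP [/andP [xt nxt] /andP [tz ntz]]; split=> //.
  by have := lt_idx xt nxt; have := lt_idx tz ntz; nlia.
have [xu uz eu] : [/\ le x u, le u z & idx u = (idx x).+1] by apply: mem; rewrite e set21.
have [xv vz ev] : [/\ le x v, le v z & idx v = (idx x).+1] by apply: mem; rewrite e set22.
by have [yu|nyu] := eqVneq y u; [exists v; split=> //; rewrite yu eq_sym | exists u; split=> //; rewrite eq_sym].
Qed.

Definition upd (F : nat -> T) k y : nat -> T := fun i => if i == k then y else F i.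

Lemma upd_flag F k y : flagfun F -> 0 < k <= n -> le (F k.-1) y -> le y (F k.+1) ->
  idx y = k -> flagfun (upd F k y).
Proof.
move=> [Fi Fl] /andP [k0 kn] ly ry iy; split=> [i iN | i j ij jn]; rewrite /upd.
  by case: eqP => [->|_] //; exact: Fi.
case: (eqVneq i k) => [ik|nik]; case: (eqVneq j k) => [jk|njk].
- exact: le_refl.
- by apply: le_trans ry _; apply: Fl; nlia.
- by apply: le_trans ly; apply: Fl; nlia.
exact: Fl.
Qed.

Lemma flag_refine G i z k : flagfun G -> i <= idx z -> idx z <= k -> k <= n.+1 ->
  le (G i) z -> le z (G k) ->
  exists G', [/\ flagfun G', G' (idx z) = z & forall m, m <= n.+1 -> m <= i \/ k <= m -> G' m = G m].
Proof.
move=> [Gi Gl] iz zk kn liz lzk.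
pose C := z |: [set G m | m : 'I_n.+2 & (m <= i) || (k <= m)].
have mem m : m <= n.+1 -> m <= i \/ k <= m -> G m \in C.
  move=> mn hm; apply/setU1P; right; apply/imsetP; exists (Ordinal (mn : m < n.+2)) => //.
  by rewrite inE /=; apply/orP.
have incz (m : 'I_n.+2) : (m <= i) || (k <= m) -> incident le z (G m).
  have mn : m <= n.+1 by rewrite -ltnS.
  rewrite /incident; case/orP => hm; apply/orP; [right|left].
    by apply: le_trans liz; apply: Gl; nlia.
  by apply: le_trans lzk _; apply: Gl.
have chC : is_chain le C.
  have memC x : x \in C -> x = z \/ exists2 m : 'I_n.+2, (m <= i) || (k <= m) & x = G m.
    by case/setU1P => [->|/imsetP [m]]; [left | rewrite inE => hm ->; right; exists m].
  apply/chainP => x y /memC [->|[m hm ->]] /memC [->|[m' hm' ->]].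
  - by rewrite /incident le_refl.
  - exact: incz.
  - by rewrite incidentC incz.
  have mn : m <= n.+1 by rewrite -ltnS.
  have mn' : m' <= n.+1 by rewrite -ltnS.
  by apply/orP; case: (leqP m m') => h; [left | right]; apply: Gl => //; apply: ltnW.
have [G' [fG' h]] := chain_flag chC.
exists G'; split=> //; first by apply: h; rewrite setU11.
by move=> m mn hm; rewrite -[in LHS](Gi m mn) h // mem.
Qed.

(* Induction on the length of the section; connectedness carries a fixed flag
   of the section from face to face. *)
Lemma rigid f : is_aut le f -> forall m G i, flagfun G -> i + m <= n.+1 ->
    (forall k, i <= k <= i + m -> f (G k) = G k) ->
  forall x, le (G i) x -> le x (G (i + m)) -> f x = x.
Proof.
move=> af; elim/ltn_ind => m IHm G i fG imn fix_ x ix xm.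
have [Gi Gl] := fG.
have fixi : f (G i) = G i by apply: fix_; nlia.
have fixm : f (G (i + m)) = G (i + m) by apply: fix_; nlia.
have [<-|nix] := eqVneq (G i) x => //.
have [->|nxm] := eqVneq x (G (i + m)) => //.
have lti := lt_idx ix nix; have ltm := lt_idx xm nxm.
rewrite !Gi in lti ltm; [| nlia..].
(* Connectedness says nothing about sections of rank at most 1; the diamond condition settles
   these. *)
have [m2|m3] := leqP m 2.
  have em : m = 2 by nlia.
  rewrite em in imn xm fix_ fixm nxm ltm.
  have [->|nx1] := eqVneq x (G i.+1); first by apply: fix_; nlia.
  have l1 : le (G i) (G i.+1) by apply: Gl; nlia.
  have l2 : le (G i.+1) (G (i + 2)) by apply: Gl; nlia.
  have i1 := Gi i ltac:(nlia); have i2 := Gi i.+1 ltac:(nlia); have i3 := Gi (i + 2) ltac:(nlia).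
  have fx1 : le (G i) (f x) by rewrite -fixi aut_le.
  have fx2 : le (f x) (G (i + 2)) by rewrite -fixm aut_le.
  have fx3 : f x != G i.+1 by rewrite -(fix_ i.+1) ?(inj_eq perm_inj) //; nlia.
  have fx4 := aut_idx af x.
  have nx1' : G i.+1 != x by rewrite eq_sym.
  by apply: (diamond (le_trans l1 l2) _ l1 l2 _ ix xm _ fx1 fx2 _ nx1' fx3); nlia.
have sec : section_connected le rk (G i) (G (i + m)).
  by case: poly => [_ [_ _]]; apply; apply: Gl; nlia.
have opn y : le (G i) y -> le y (G (i + m)) -> i < idx y < i + m -> y \in open_section le (G i) (G (i + m)).
  move=> ly ry /andP [h1 h2]; rewrite inE /Defs.ltP ly ry /=; apply/andP; split; apply/eqP => e.
    by move: h1; rewrite -e Gi; nlia.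
  by move: h2; rewrite e Gi; nlia.
have [s [ps ls alls]] : exists s : seq T, [/\ path (incident le) (G i.+1) s, last (G i.+1) s = x &
                        all (fun z => z \in open_section le (G i) (G (i + m))) s].
  apply: sec.
  - by rewrite !rk_idx !Gi; nlia.
  - by apply: opn => //; rewrite ?Gi; try apply: Gl; nlia.
  by apply: opn => //; nlia.
pose inv y := exists G', [/\ flagfun G', G' i = G i, G' (i + m) = G (i + m),
   (forall k, i <= k <= i + m -> f (G' k) = G' k) & i < idx y < i + m /\ G' (idx y) = y].
suff : inv x by case=> G' [_ _ _ h [hx <-]]; apply: h; nlia.
have inv1 : inv (G i.+1).
  by exists G; split=> //; rewrite Gi; try split=> //; nlia.
rewrite -ls; elim: s {ls} (G i.+1) inv1 ps alls => [|z s IHs] //= y iy /andP [yz ps] /andP [zo alls].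
apply: IHs => //.
have [G' [fG' e1 e2 fix' [hy ey]]] := iy.
have [Gi' Gl'] := fG'.
have [liz lzm hz] : [/\ le (G' i) z, le z (G' (i + m)) & i < idx z < i + m].
  move: zo; rewrite inE /Defs.ltP => /andP [/andP [h1 h2] /andP [h3 h4]].
  have := lt_idx h1 h2; have := lt_idx h3 h4; rewrite !Gi; [|nlia..].
  by rewrite e1 e2; split=> //; nlia.
have [lzy|lyz] := leqP (idx z) (idx y).
- have zy : le z y by apply: incident_le; rewrite 1?incidentC.
  have fixs t : le (G' i) t -> le t y -> f t = t.
    move=> it ty; apply: (IHm (idx y - i) _ G' i) => //; rewrite ?subnKC; try nlia.
    - by move=> k hk; apply: fix'; nlia.
    - by rewrite ey.
  have [G2 [fG2 ez same]] := flag_refine (i := i) (z := z) (k := idx y) fG' ltac:(nlia) ltac:(nlia) ltac:(nlia) liz ltac:(by rewrite ey).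
  exists G2; split=> //.
  + by rewrite same ?e1 //; [nlia | left].
  + by rewrite same ?e2 //; right; nlia.
  move=> k hk; have [ky|yk] := leqP k (idx y).
    have [Gi2 Gl2] := fG2; apply: fixs.
      by rewrite -(same i) //; [apply: Gl2; nlia | nlia | left].
    by rewrite -ey -(same (idx y)) //; [apply: Gl2; nlia | nlia | right].
  by rewrite same; [apply: fix'; nlia | nlia | right; nlia].
have yz' : le y z by apply: incident_le => //; nlia.
have fixs t : le y t -> le t (G' (i + m)) -> f t = t.
  move=> yt tm; apply: (IHm (i + m - idx y) _ G' (idx y)) => //; rewrite ?subnKC; try nlia.
  - by move=> k hk; apply: fix'; nlia.
  - by rewrite ey.
  by [].
have [G2 [fG2 ez same]] := flag_refine (i := idx y) (z := z) (k := i + m) fG' ltac:(nlia) ltac:(nlia) ltac:(nlia) ltac:(by rewrite ey) lzm.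
exists G2; split=> //.
+ by rewrite same ?e1 //; [nlia | left; nlia].
+ by rewrite same ?e2 //; right; nlia.
move=> k hk; have [yk|ky] := leqP (idx y) k.
  have [Gi2 Gl2] := fG2; apply: fixs.
    by rewrite -ey -(same (idx y)) //; [apply: Gl2; nlia | nlia | left].
  by rewrite -(same (i + m)) //; [apply: Gl2; nlia | right].
by rewrite same; [apply: fix'; nlia | nlia | left; nlia].
Qed.

Lemma least_flag F x : flagfun F -> le (F 0) x.
Proof.
move=> [Fi _]; case: poly => [[_ [L hL] _ _ _] _].
suff -> : F 0 = L by exact: hL.
apply/esym/le_idx_eq; first exact: hL.
by have := le_idx (hL (F 0)); rewrite Fi //; nlia.
Qed.

Lemma greatest_flag F x : flagfun F -> le x (F n.+1).
Proof.
move=> [Fi _]; case: poly => [[_ _ [U hU] _ _] _].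
suff -> : F n.+1 = U by exact: hU.
apply: le_idx_eq; first exact: hU.
by have := le_idx (hU (F n.+1)); rewrite Fi //; have := idx_max U; nlia.
Qed.

Lemma rigid_flag f F : is_aut le f -> flagfun F -> (forall k, k <= n.+1 -> f (F k) = F k) -> f = 1%g.
Proof.
move=> af fF h; apply/permP => x; rewrite perm1.
apply: (rigid (m := n.+1) (i := 0) af fF) => //; first exact: least_flag.
exact: greatest_flag.
Qed.

Lemma imset_flagset f F G : (forall k, k <= n.+1 -> f (F k) = G k) -> f @: flagset F = flagset G.
Proof.
move=> h; apply/setP => x; apply/imsetP/mem_flagset.
  by case=> _ /mem_flagset [k kn ->] ->; exists k; rewrite ?h.
by case=> k kn ->; exists (F k); rewrite ?h //; apply/mem_flagset; exists k.
Qed.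

Lemma imset_flagset_inv f F G : is_aut le f -> flagfun F -> flagfun G ->
  f @: flagset F = flagset G -> forall k, k <= n.+1 -> f (F k) = G k.
Proof.
move=> af [Fi _] [Gi _] e k kn.
have /mem_flagset [l ln Gl] : f (F k) \in flagset G.
  by rewrite -e; apply: imset_f; apply/mem_flagset; exists k.
by have := aut_idx af (F k); rewrite Gl Gi // Fi // => <-.
Qed.

Lemma aut_flag f F : is_aut le f -> flagfun F -> flagfun (fun k => f (F k)).
Proof.
move=> af [Fi Fl]; split=> [k kn | i j ij jn]; first by rewrite aut_idx ?Fi.
by rewrite aut_le ?Fl.
Qed.

Definition adjacent (F G : nat -> T) k := [/\ flagfun F, flagfun G, k <= n.+1, F k != G k &
  forall i, i <= n.+1 -> i != k -> F i = G i].

Lemma adjacent_card F G k : adjacent F G k -> #|flagset F :\: flagset G| = 1.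
Proof.
move=> [[Fi Fl] [Gi Gl] kn nk same].
suff -> : flagset F :\: flagset G = [set F k] by rewrite cards1.
apply/setP => x; rewrite in_setD in_set1; apply/andP/eqP => [[xG /mem_flagset [i iN ex]]|->].
  have [eik|nik] := eqVneq i k; first by rewrite ex eik.
  by case/negP: xG; rewrite ex same //; apply/mem_flagset; exists i.
split; last by apply/mem_flagset; exists k.
apply/mem_flagset => [[i iN e]]; case/eqP: nk.
by have := Fi k kn; rewrite e Gi // => <-.
Qed.

Lemma orbit_aut f C : is_aut le f -> C \in flags le -> f @: C \in flags le ->
  flag_orbit le (f @: C) = flag_orbit le C.
Proof.
move=> af fC ffC; apply/setP => D; rewrite !inE; congr (_ && _).
apply/existsP/existsP => [[g /andP [ag /eqP <-]]|[g /andP [ag /eqP <-]]].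
  exists (f * g)%g; rewrite autM //=; apply/eqP.
  by rewrite -imset_comp; apply: eq_imset => x; rewrite permM.
exists (f^-1 * g)%g; rewrite autM ?autV //=; apply/eqP.
by rewrite -imset_comp; apply: eq_imset => x /=; rewrite permM permK.
Qed.

(** * Consequences of chirality *)

Hypothesis chir : chiral le.

Lemma adjacent_not_equivalent F G k f : adjacent F G k -> is_aut le f ->
  ~ (forall i, i <= n.+1 -> f (F i) = G i).
Proof.
move=> adj af /imset_flagset e; have [fF fG _ _ _] := adj.
have [_ /(_ _ _ (flagset_flag fF) (flagset_flag fG) (adjacent_card adj))] := chir.
by rewrite -e orbit_aut ?eqxx ?e // flagset_flag.
Qed.

Lemma two_orbits F G G' k : flagfun F -> adjacent G G' k ->
  (exists2 f, is_aut le f & forall i, i <= n.+1 -> f (F i) = G i) \/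
  (exists2 f, is_aut le f & forall i, i <= n.+1 -> f (F i) = G' i).
Proof.
move=> fF adj; have [fG fG' _ _ _] := adj.
have ex H : flagfun H -> flag_orbit le (flagset F) = flag_orbit le (flagset H) ->
    exists2 f, is_aut le f & forall i, i <= n.+1 -> f (F i) = H i.
  move=> fH e; have : flagset H \in flag_orbit le (flagset H).
    rewrite inE flagset_flag //=; apply/existsP; exists 1%g; rewrite aut1 /=.
    by apply/eqP; rewrite -[RHS]imset_id; apply: eq_imset => x; rewrite perm1.
  rewrite -e inE => /andP [_ /existsP [f /andP [af /eqP ef]]].
  by exists f => //; apply: imset_flagset_inv ef.
have orb H : flagfun H -> flag_orbit le (flagset H) \in flag_orbits le.
  by move=> fH; apply: imset_f; apply: flagset_flag.
have [/eqP/cards2P [u [v [_ e]]] /(_ _ _ (flagset_flag fG) (flagset_flag fG') (adjacent_card adj)) ne] := chir.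
have := orb _ fF; have := orb _ fG; have := orb _ fG'; rewrite e !in_set2.
have [eFG|nFG] := eqVneq (flag_orbit le (flagset F)) (flag_orbit le (flagset G)).
  by left; apply: ex.
move=> oG' oG oF; right; apply: ex => //; move: ne nFG.
by case/orP: oG' => /eqP ->; case/orP: oG => /eqP ->; case/orP: oF => /eqP ->; rewrite ?eqxx.
Qed.

Section BaseFlag.
Variable F : nat -> T.
Hypothesis fF : flagfun F.

(** The face in which the adjacent flag differs from [F]. For [0 < k <= n] the default [F 0] is
    never reached, by the diamond condition. *)
Definition other k : T :=
  odflt (F 0) [pick y | [&& le (F k.-1) y, le y (F k.+1), idx y == k & y != F k]].

Lemma otherP k : 0 < k <= n ->
  [/\ le (F k.-1) (other k), le (other k) (F k.+1), idx (other k) = k & other k != F k].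
Proof.
move=> kn; have [Fi Fl] := fF.
have e1 := Fi k.-1 ltac:(nlia); have e2 := Fi k ltac:(nlia); have e3 := Fi k.+1 ltac:(nlia).
have [||||y [h1 h2 h3 h4]] := @diamond_other (F k.-1) (F k) (F k.+1).
- by apply: Fl; nlia.
- by apply: Fl; nlia.
- by nlia.
- by nlia.
rewrite /other; case: pickP => [z /and4P [? ? /eqP ? ?] // | /(_ y)].
by rewrite h1 h2 h4 h3 e1 prednK ?eqxx //; nlia.
Qed.

Lemma flag_diamond G k y y' y'' : flagfun G -> 0 < k <= n ->
  le (G k.-1) y -> le y (G k.+1) -> idx y = k ->
  le (G k.-1) y' -> le y' (G k.+1) -> idx y' = k ->
  le (G k.-1) y'' -> le y'' (G k.+1) -> idx y'' = k -> y != y' -> y'' != y -> y'' = y'.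
Proof.
move=> [Gi Gl] kn h1 h2 h3 h4 h5 h6 h7 h8 h9.
have e1 := Gi k.-1 ltac:(nlia); have e3 := Gi k.+1 ltac:(nlia).
by apply: (@diamond (G k.-1) (G k.+1)) => //; [apply: Gl| ..]; nlia.
Qed.

Lemma adjacent_upd k y : 0 < k <= n -> le (F k.-1) y -> le y (F k.+1) -> idx y = k -> y != F k ->
  adjacent F (upd F k y) k.
Proof.
move=> kn h1 h2 h3 h4; split=> //; first exact: upd_flag.
- by nlia.
- by rewrite /upd eqxx eq_sym.
by move=> i _ /negbTE; rewrite /upd => ->.
Qed.

(** Two successive changes of a flag, in ranks [i.+1] and [i], lead back to its orbit. By
    [two_orbits], [F] is equivalent to the final or to the intermediate flag, and the latter is
    adjacent to [F]. *)
Lemma rotation_exists i : 0 < i < n -> exists A : {perm T},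
  [/\ is_aut le A, A (F i.+1) = other i.+1, A (other i) = F i &
      forall k, k <= n.+1 -> k != i -> k != i.+1 -> A (F k) = F k].
Proof.
move=> iN; have [Fi Fl] := fF.
have [o1 o2 o3 o4] := @otherP i.+1 ltac:(nlia).
have [q1 q2 q3 q4] := @otherP i ltac:(nlia).
have adj1 := @adjacent_upd i.+1 _ ltac:(nlia) o1 o2 o3 o4.
set G := upd _ _ _ in adj1; have [_ fG _ _ _] := adj1; have [Gi Gl] := fG.
have Gsame k : k != i.+1 -> G k = F k by move=> /negbTE h; rewrite /G /upd h.
have GS : G i.+1 = other i.+1 by rewrite /G /upd eqxx.
have [||||y [h1 h2 h3 h4]] := @diamond_other (G i.-1) (G i) (G i.+1).
- by apply: Gl; nlia.
- by apply: Gl; nlia.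
- by rewrite !Gi; nlia.
- by rewrite !Gi; nlia.
have iy : idx y = i by rewrite h3 Gi; nlia.
have fG' : flagfun (upd G i y) by apply: upd_flag => //; nlia.
have adj2 : adjacent G (upd G i y) i.
  split=> //; first nlia.
    by rewrite /upd eqxx eq_sym.
  by move=> k _ /negbTE; rewrite /upd => ->.
case: (two_orbits fF adj2) => [[f af hf] | [A aA hA]].
  by case: (adjacent_not_equivalent adj1 af hf).
exists A; split=> //.
- rewrite hA; last nlia.
  by rewrite /upd -GS; case: eqP => //; nlia.
- have AS : A (F i.+1) = G i.+1.
    by rewrite hA; [rewrite /upd; case: eqP => //; nlia | nlia].
  have Ai : A (F i) = y by rewrite hA; [rewrite /upd eqxx | nlia].
  have Ap : A (F i.-1) = G i.-1.
    by rewrite hA; [rewrite /upd; case: eqP => //; nlia | nlia].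
  apply: (flag_diamond (G := G) (k := i) (y := y)) => //; try nlia.
  + by rewrite Gsame; [apply: Fl; nlia | nlia].
  + by rewrite GS.
  + by apply: Fi; nlia.
  + by rewrite -Ap aut_le.
  + by rewrite -AS aut_le.
  + by rewrite aut_idx.
  + by rewrite -(Gsame i) //; nlia.
  + by rewrite -Ai (inj_eq perm_inj).
move=> k kn nk nk'; rewrite hA // /upd (negbTE nk).
exact: Gsame.
Qed.

(** Otherwise [f] would map [F] to an adjacent flag. *)
Lemma fix_all_but_one f k0 : is_aut le f -> 0 < k0 <= n ->
  (forall k, k <= n.+1 -> k != k0 -> f (F k) = F k) -> f = 1%g.
Proof.
move=> af k0n h; apply: (rigid_flag af fF) => k kn.
have [->|nk] := eqVneq k k0; last exact: h.
apply/eqP; apply: contraT => nf; exfalso.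
apply: (@adjacent_not_equivalent F (fun i => f (F i)) k0 f) => //; split=> //.
- exact: aut_flag.
- by nlia.
- by rewrite eq_sym.
by move=> i iN ni; rewrite h.
Qed.

Lemma fix_square f k : is_aut le f -> 0 < k <= n -> f (F k.-1) = F k.-1 -> f (F k.+1) = F k.+1 ->
  f (f (F k)) = F k.
Proof.
move=> af kn h1 h2; have [Fi Fl] := fF.
have [e|ne] := eqVneq (f (F k)) (F k); first by rewrite !e.
have l1 : le (F k.-1) (F k) by apply: Fl; nlia.
have l2 : le (F k) (F k.+1) by apply: Fl; nlia.
have ik : idx (F k) = k by apply: Fi; nlia.
have l3 : le (F k.-1) (f (F k)) by rewrite -h1 aut_le.
have l4 : le (f (F k)) (F k.+1) by rewrite -h2 aut_le.
apply: (flag_diamond (G := F) (k := k) (y := f (F k))); rewrite ?aut_idx //.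
- by rewrite -h1 aut_le.
- by rewrite -h2 aut_le.
by rewrite (inj_eq perm_inj).
Qed.

Lemma fix_or_other f k : is_aut le f -> 0 < k <= n -> f (F k.-1) = F k.-1 -> f (F k.+1) = F k.+1 ->
  f (F k) <> F k -> f (F k) = other k.
Proof.
move=> af kn h1 h2 ne; have [Fi Fl] := fF; have [o1 o2 o3 o4] := otherP kn.
have l1 : le (F k.-1) (F k) by apply: Fl; nlia.
have l2 : le (F k) (F k.+1) by apply: Fl; nlia.
have ik : idx (F k) = k by apply: Fi; nlia.
apply: (flag_diamond (G := F) (k := k) (y := F k)); rewrite ?aut_idx //.
- by rewrite -h1 aut_le.
- by rewrite -h2 aut_le.
- by rewrite eq_sym.
exact/eqP.
Qed.

(** The orbits of [F i] and [F i.+1] under [<A>] form a set [S] closed under incidence within the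
    section, so by connectedness every vertex of the polygon lies in the orbit of [F i]. *)
Lemma order_rotation A i : 0 < i < n -> is_aut le A -> A (F i.+1) = other i.+1 -> A (other i) = F i ->
  A (F i.-1) = F i.-1 -> A (F i.+2) = F i.+2 ->
  #|[set x | [&& le (F i.-1) x, le x (F i.+2) & idx x == i]]| <= #[A]%g.
Proof.
move=> iN aA A1 A2 A3 A4; have [Fi Fl] := fF.
have [o1 o2 o3 o4] := @otherP i.+1 ltac:(nlia).
have [q1 q2 q3 q4] := @otherP i ltac:(nlia).
have aX k : is_aut le (A ^+ k)%g.
  by elim: k => [|k IHk]; [exact: aut1 | rewrite expgS autM].
have cyc g : g \in <[A]>%g -> [/\ is_aut le g, g (F i.-1) = F i.-1 & g (F i.+2) = F i.+2].
  case/cycleP => k ->; split=> //.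
    by elim: k => [|k IHk]; rewrite ?perm1 // expgS permM A3.
  by elim: k => [|k IHk]; rewrite ?perm1 // expgS permM A4.
pose S := [set g (F i) | g : {perm T} in <[A]>%g] :|: [set g (F i.+1) | g : {perm T} in <[A]>%g].
have l1 : le (F i.-1) (F i) by apply: Fl; nlia.
have l2 : le (F i) (F i.+1) by apply: Fl; nlia.
have l3 : le (F i.+1) (F i.+2) by apply: Fl; nlia.
have e0 := Fi i.-1 ltac:(nlia); have e1 := Fi i ltac:(nlia); have e2 := Fi i.+1 ltac:(nlia).
have e3 := Fi i.+2 ltac:(nlia).
have step x y : x \in S -> incident le x y -> y \in open_section le (F i.-1) (F i.+2) -> y \in S.
  move=> xS xy; rewrite inE /Defs.ltP => /andP [/andP [h1 h1'] /andP [h2 h2']].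
  have iy : idx y = i \/ idx y = i.+1.
    by have := lt_idx h1 h1'; have := lt_idx h2 h2'; rewrite e0 e3; nlia.
  case/setUP: xS => /imsetP [g gA ex].
  - have [ag g1 g2] := cyc g gA; have [agV gV1 gV2] := cyc g^-1%g (groupVr gA).
    have ix : idx x = i by rewrite ex aut_idx.
    case: iy => iy.
      suff -> : y = x by apply/setUP; left; rewrite ex; apply: imset_f.
      by apply/esym; apply: le_idx_eq; [apply: incident_le => //; nlia | nlia].
    have lxy : le x y by apply: incident_le => //; nlia.
    apply/setUP; right; apply/imsetP.
    have gy1 : le (F i) (g^-1%g y) by rewrite -(aut_le ag) permKV -ex.
    have gy2 : le (g^-1%g y) (F i.+2) by rewrite -gV2 aut_le.
    have gy3 : idx (g^-1%g y) = i.+1 by rewrite aut_idx.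
    have [e|ne] := eqVneq (g^-1%g y) (F i.+1).
      by exists g => //; rewrite -e permKV.
    have e : g^-1%g y = other i.+1.
      apply: (flag_diamond (G := F) (k := i.+1) (y := F i.+1)) => //; try nlia.
      by rewrite eq_sym.
    by exists (A * g)%g; rewrite ?groupM ?cycle_id // permM A1 -e permKV.
  have [ag g1 g2] := cyc g gA; have [agV gV1 gV2] := cyc g^-1%g (groupVr gA).
  have ix : idx x = i.+1 by rewrite ex aut_idx.
  case: iy => iy; last first.
    suff -> : y = x by apply/setUP; right; rewrite ex; apply: imset_f.
    by apply/esym; apply: le_idx_eq; [apply: incident_le => //; nlia | nlia].
  have lxy : le y x by apply: incident_le; rewrite 1?incidentC //; nlia.
  apply/setUP; left; apply/imsetP.
  have gy1 : le (g^-1%g y) (F i.+1) by rewrite -(aut_le ag) permKV -ex.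
  have gy2 : le (F i.-1) (g^-1%g y) by rewrite -gV1 aut_le.
  have gy3 : idx (g^-1%g y) = i by rewrite aut_idx.
  have [e|ne] := eqVneq (g^-1%g y) (F i).
    by exists g => //; rewrite -e permKV.
  have e : g^-1%g y = other i.
    apply: (flag_diamond (G := F) (k := i) (y := F i)) => //; try nlia.
    by rewrite eq_sym.
  exists (A^-1 * g)%g; rewrite ?groupM ?groupV ?cycle_id // permM -A2 permK -e permKV //.
have base : F i \in S.
  by apply/setUP; left; apply/imsetP; exists 1%g; rewrite ?group1 ?perm1.
have opn x : le (F i.-1) x -> le x (F i.+2) -> idx x = i -> x \in open_section le (F i.-1) (F i.+2).
  move=> h1 h2 h3; rewrite inE /Defs.ltP h1 h2 /=.
  by apply/andP; split; apply/eqP => e; [move: h3; rewrite -e e0 | move: h3; rewrite e e3]; nlia.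
have all_S x : le (F i.-1) x -> le x (F i.+2) -> idx x = i -> x \in S.
  move=> h1 h2 h3.
  have sec : section_connected le rk (F i.-1) (F i.+2).
    by case: poly => [_ [_ _]]; apply; apply: Fl; nlia.
  have rk2 : (rk (F i.+2) - rk (F i.-1) - 1 >= 2)%R by rewrite !rk_idx e0 e3; nlia.
  have [s [ps ls alls]] := sec rk2 (F i) x (opn _ l1 (le_trans l2 l3) e1) (opn x h1 h2 h3).
  rewrite -ls; elim: s (F i) base ps alls {ls} => [|z s IHs] //= y yS /andP [yz ps] /andP [zo alls].
  by apply: IHs => //; apply: step yz zo.
apply: leq_trans (leq_imset_card (fun g : {perm T} => g (F i)) _).
apply: subset_leq_card; apply/subsetP => x; rewrite inE => /and3P [h1 h2 /eqP h3].
case/setUP: (all_S x h1 h2 h3) => // /imsetP [g gA ex].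
by have [ag _ _] := cyc g gA; move: h3; rewrite ex aut_idx // e2; nlia.
Qed.

(** Automorphisms act freely on flags, and [F] and an adjacent flag have disjoint orbits. *)
Lemma card_aut : 0 < n -> #|[set f | is_aut le f]| * 2 <= #|flags le|.
Proof.
move=> n0; have [o1 o2 o3 o4] := @otherP 1 ltac:(nlia).
have adj := @adjacent_upd 1 _ ltac:(nlia) o1 o2 o3 o4.
set G := upd _ _ _ in adj; have [_ fG _ _ _] := adj.
pose h (u : {perm T} * bool) := u.1 @: flagset (if u.2 then F else G).
have fl (e : bool) : flagfun (if e then F else G) by case: e.
have injh : {in setX [set f | is_aut le f] [set: bool] &, injective h}.
  move=> [f e] [g e'] /setXP [/=]; rewrite inE => af _ /setXP [/=]; rewrite inE => ag _.
  rewrite /h /= => E.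
  have E' : (f * g^-1)%g @: flagset (if e then F else G) = flagset (if e' then F else G).
    have -> : (f * g^-1)%g @: flagset (if e then F else G) = g^-1%g @: (f @: flagset (if e then F else G)).
      by rewrite -imset_comp; apply: eq_imset => x; rewrite permM.
    rewrite E -imset_comp -[RHS]imset_id; apply: eq_imset => x /=.
    by rewrite permK.
  have afg : is_aut le (f * g^-1)%g by rewrite autM ?autV.
  have E2 := imset_flagset_inv afg (fl e) (fl e') E'.
  have ee : e = e'.
    case: e e' E2 {E E'} => [] [] // E2.
      by case: (adjacent_not_equivalent adj afg E2).
    exfalso; apply: (adjacent_not_equivalent adj (autV afg)) => i iN.
    by rewrite -E2 // permK.
  rewrite -ee in E2 *; congr (_, _).
  have := rigid_flag afg (fl e) E2 => /eqP; rewrite -eq_mulgV1 => /eqP //.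
have <- : #|setX [set f | is_aut le f] [set: bool]| = #|[set f | is_aut le f]| * 2.
  by rewrite cardsX cardsT card_bool.
rewrite -(card_in_imset injh); apply: subset_leq_card; apply/subsetP => C /imsetP [[f e] /setXP [af _] ->].
rewrite inE /= in af; rewrite /h /=.
by rewrite (imset_flagset (G := fun k => f ((if e then F else G) k))) // flagset_flag //; apply: aut_flag.
Qed.

End BaseFlag.
End Polytope.

(** * The rotation group of a tight chiral 5-polytope *)

Section TightChiral.
Local Open Scope group_scope.
Variables (T : finType) (le : rel T) (rk : T -> int) (p : nat -> nat).
Hypothesis poly : is_polytope le rk 5.
Hypothesis equi : equivelar le rk 5 p.
Hypothesis chir : chiral le.
Hypothesis tigh : tight le 5 p.
Variable F : nat -> T.
Hypothesis fF : flagfun le rk 5 F.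

Local Notation o := (other le rk F).
Local Notation aut := (is_aut le).

Variables a b c d : {perm T}.
Hypothesis autA : aut a.
Hypothesis autB : aut b.
Hypothesis autC : aut c.
Hypothesis autD : aut d.
Hypothesis a2 : a (F 2) = o 2.
Hypothesis a1 : a (o 1) = F 1.
Hypothesis aF : forall k, k <= 6 -> k != 1%N -> k != 2 -> a (F k) = F k.
Hypothesis b3 : b (F 3) = o 3.
Hypothesis b2 : b (o 2) = F 2.
Hypothesis bF : forall k, k <= 6 -> k != 2 -> k != 3 -> b (F k) = F k.
Hypothesis c4 : c (F 4) = o 4.
Hypothesis c3 : c (o 3) = F 3.
Hypothesis cF : forall k, k <= 6 -> k != 3 -> k != 4 -> c (F k) = F k.
Hypothesis d5 : d (F 5) = o 5.
Hypothesis d4 : d (o 4) = F 4.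
Hypothesis dF : forall k, k <= 6 -> k != 4 -> k != 5 -> d (F k) = F k.

Lemma fix_rigid f : aut f -> (forall k, k <= 6 -> f (F k) = F k) -> f = 1.
Proof. by move=> af; apply: (rigid_flag poly af fF). Qed.

Lemma fix_but_one f k0 : aut f -> 0 < k0 <= 5 ->
  (forall k, k <= 6 -> k != k0 -> f (F k) = F k) -> f = 1.
Proof. by move=> af hk; apply: (fix_all_but_one poly chir fF af hk). Qed.

(** If [f] fixes both neighbours of [F k] in the base flag, the diamond condition lets it at most
    exchange two faces. *)
Lemma square_one f : aut f ->
  (forall k, k <= 6 -> f (F k) = F k \/ [/\ 0 < k <= 5, f (F k.-1) = F k.-1 & f (F k.+1) = F k.+1]) ->
  f * f = 1.
Proof.
move=> af h; apply: fix_rigid; first exact: autM.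
move=> k kn; rewrite permM; case: (h k kn) => [e|[h1 h2 h3]]; first by rewrite !e.
exact: (fix_square poly fF).
Qed.

Lemma upto6 (Q : nat -> Prop) : Q 0 -> Q 1%N -> Q 2 -> Q 3 -> Q 4 -> Q 5 -> Q 6 -> forall k, k <= 6 -> Q k.
Proof. by move=> ? ? ? ? ? ? ? [|[|[|[|[|[|[|k]]]]]]]. Qed.

Lemma rel_ab : a * b * (a * b) = 1.
Proof.
apply: square_one; first exact: autM.
have e2 : (a * b) (F 2) = F 2 by rewrite permM a2 b2.
have e k : k <= 6 -> 3 < k \/ k = 0 -> (a * b) (F k) = F k.
  by move=> kn hk; rewrite permM aF ?bF //; lia.
by apply: upto6; [left|right|left|right|left|left|left]; rewrite ?e2 ?e //; lia.
Qed.

Lemma rel_bc : b * c * (b * c) = 1.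
Proof.
apply: square_one; first exact: autM.
have e3 : (b * c) (F 3) = F 3 by rewrite permM b3 c3.
have e k : k <= 6 -> 4 < k \/ k <= 1 -> (b * c) (F k) = F k.
  by move=> kn hk; rewrite permM bF ?cF //; lia.
by apply: upto6; [left|left|right|left|right|left|left]; rewrite ?e3 ?e //; lia.
Qed.

Lemma rel_cd : c * d * (c * d) = 1.
Proof.
apply: square_one; first exact: autM.
have e4 : (c * d) (F 4) = F 4 by rewrite permM c4 d4.
have e k : k <= 6 -> 5 < k \/ k <= 2 -> (c * d) (F k) = F k.
  by move=> kn hk; rewrite permM cF ?dF //; lia.
by apply: upto6; [left|left|left|right|left|right|left]; rewrite ?e4 ?e //; lia.
Qed.

Lemma rel_abc : a * b * c * (a * b * c) = 1.
Proof.
apply: square_one; first by rewrite !autM.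
have e2 : (a * b * c) (F 2) = F 2 by rewrite !permM a2 b2 cF.
have e3 : (a * b * c) (F 3) = F 3 by rewrite !permM aF // b3 c3.
have e k : k <= 6 -> 4 < k \/ k = 0 -> (a * b * c) (F k) = F k.
  by move=> kn hk; rewrite !permM aF ?bF ?cF //; lia.
by apply: upto6; [left|right|left|left|right|left|left]; rewrite ?e2 ?e3 ?e //; lia.
Qed.

Lemma rel_bcd : b * c * d * (b * c * d) = 1.
Proof.
apply: square_one; first by rewrite !autM.
have e3 : (b * c * d) (F 3) = F 3 by rewrite !permM b3 c3 dF.
have e4 : (b * c * d) (F 4) = F 4 by rewrite !permM bF // c4 d4.
have e k : k <= 6 -> 5 < k \/ k <= 1 -> (b * c * d) (F k) = F k.
  by move=> kn hk; rewrite !permM bF ?cF ?dF //; lia.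
by apply: upto6; [left|left|right|left|left|right|left]; rewrite ?e3 ?e4 ?e //; lia.
Qed.

Lemma rel_abcd : a * b * c * d * (a * b * c * d) = 1.
Proof.
apply: square_one; first by rewrite !autM.
have e2 : (a * b * c * d) (F 2) = F 2 by rewrite !permM a2 b2 cF // dF.
have e3 : (a * b * c * d) (F 3) = F 3 by rewrite !permM aF // b3 c3 dF.
have e4 : (a * b * c * d) (F 4) = F 4 by rewrite !permM aF // bF // c4 d4.
have e k : k <= 6 -> 5 < k \/ k = 0 -> (a * b * c * d) (F k) = F k.
  by move=> kn hk; rewrite !permM aF ?bF ?cF ?dF //; lia.
by apply: upto6; [left|right|left|left|left|right|left]; rewrite ?e2 ?e3 ?e4 ?e //; lia.
Qed.

(** By rigidity [d] fixes every face below [F 3] and [a] every face above it, so the two commute on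
    the base flag. *)
Lemma rel_da : d * a = a * d.
Proof.
have [Fi Fl] := fF.
have dfix x : le x (F 3) -> d x = x.
  move=> x3; apply: (rigid poly (m := 3) (i := 0) autD fF) => //; last exact: (least_flag poly).
  by move=> k hk; apply: dF; lia.
have afix x : le (F 3) x -> a x = x.
  move=> x3; apply: (rigid poly (m := 3) (i := 3) autA fF) => //; last exact: (greatest_flag poly).
  by move=> k hk; apply: aF; lia.
apply/eqP; rewrite eq_mulgV1; apply/eqP; apply: fix_rigid; first by rewrite autM ?autV ?autM.
move=> k kn; rewrite permM; apply: (@perm_inj _ (a * d)); rewrite permKV !permM.
have [k3|k3] := leqP k 3.
  rewrite dF ?[d (a _)]dfix //; try lia.
  by rewrite -(aF (k := 3)) // aut_le //; apply: Fl.
rewrite [a (F k)]aF ?[a (d _)]afix //; try lia.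
by rewrite -(dF (k := 3)) // aut_le //; apply: Fl => //; lia.
Qed.

Lemma cyc_fix (A g : {perm T}) x : g \in <[A]> -> A x = x -> g x = x.
Proof.
case/cycleP => k -> e; elim: k => [|k IHk]; first by rewrite perm1.
by rewrite expgS permM e.
Qed.

Lemma cyc_aut (A g : {perm T}) : g \in <[A]> -> aut A -> aut g.
Proof.
case/cycleP => k -> e; elim: k => [|k IHk]; first exact: aut1.
by rewrite expgS autM.
Qed.

Lemma a_free g : g \in <[a]> -> g (F 1) = F 1 -> g = 1.
Proof.
move=> gA g1; apply: (fix_but_one (k0 := 2)) => //; first exact: cyc_aut gA _.
by move=> k kn k2; have [->|k1] := eqVneq k 1%N => //; apply: cyc_fix gA _; apply: aF.
Qed.

Lemma b_free g : g \in <[b]> -> g (F 2) = F 2 -> g = 1.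
Proof.
move=> gB g1; apply: (fix_but_one (k0 := 3)) => //; first exact: cyc_aut gB _.
by move=> k kn k2; have [->|k1] := eqVneq k 2 => //; apply: cyc_fix gB _; apply: bF.
Qed.

Lemma c_free g : g \in <[c]> -> g (F 3) = F 3 \/ g (F 4) = F 4 -> g = 1.
Proof.
move=> gC [] g1; have ag := cyc_aut gC autC.
  apply: (fix_but_one (k0 := 4)) => // k kn k2.
  by have [->|k1] := eqVneq k 3 => //; apply: cyc_fix gC _; apply: cF.
apply: (fix_but_one (k0 := 3)) => // k kn k2.
by have [->|k1] := eqVneq k 4 => //; apply: cyc_fix gC _; apply: cF.
Qed.

Lemma d_free g : g \in <[d]> -> g (F 5) = F 5 -> g = 1.
Proof.
move=> gD g1; apply: (fix_but_one (k0 := 4)) => //; first exact: cyc_aut gD _.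
by move=> k kn k2; have [->|k1] := eqVneq k 5 => //; apply: cyc_fix gD _; apply: dF.
Qed.

(** The leftmost factor of a product acts first, and [d], [c], [b] fix [F 1]; so the image of [F 1]
    determines [t]. Then [F 2] determines [s], and [F 3] determines [v]. *)
Lemma normal_form_inj u u' v v' s s' t t' :
    u \in <[d]> -> u' \in <[d]> -> v \in <[c]> -> v' \in <[c]> ->
    s \in <[b]> -> s' \in <[b]> -> t \in <[a]> -> t' \in <[a]> ->
  u * v * s * t = u' * v' * s' * t' -> [/\ u = u', v = v', s = s' & t = t'].
Proof.
move=> uD u'D vC v'C sB s'B tA t'A e.
have fx1 x : x \in <[d]> -> x (F 1) = F 1 by move=> h; apply: cyc_fix h _; apply: dF.
have fx2 x : x \in <[d]> -> x (F 2) = F 2 by move=> h; apply: cyc_fix h _; apply: dF.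
have fx3 x : x \in <[d]> -> x (F 3) = F 3 by move=> h; apply: cyc_fix h _; apply: dF.
have cx1 x : x \in <[c]> -> x (F 1) = F 1 by move=> h; apply: cyc_fix h _; apply: cF.
have cx2 x : x \in <[c]> -> x (F 2) = F 2 by move=> h; apply: cyc_fix h _; apply: cF.
have bx1 x : x \in <[b]> -> x (F 1) = F 1 by move=> h; apply: cyc_fix h _; apply: bF.
have quo (A x x' : {perm T}) y : x \in <[A]> -> x' \in <[A]> -> x y = x' y ->
    (x * x'^-1) \in <[A]> /\ (x * x'^-1) y = y.
  by move=> xA x'A exy; rewrite groupM ?groupV // permM exy permK.
have et : t = t'.
  have e1 := congr1 (fun f : {perm T} => f (F 1)) e.
  rewrite /= !permM (fx1 _ uD) (fx1 _ u'D) (cx1 _ vC) (cx1 _ v'C) (bx1 _ sB) (bx1 _ s'B) in e1.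
  by have [h1 h2] := quo _ _ _ _ tA t'A e1; apply/eqP; rewrite eq_mulgV1 (a_free h1 h2).
move: e; rewrite et => /mulIg e.
have es : s = s'.
  have e1 := congr1 (fun f : {perm T} => f (F 2)) e.
  rewrite /= !permM (fx2 _ uD) (fx2 _ u'D) (cx2 _ vC) (cx2 _ v'C) in e1.
  by have [h1 h2] := quo _ _ _ _ sB s'B e1; apply/eqP; rewrite eq_mulgV1 (b_free h1 h2).
move: e; rewrite es => /mulIg e.
have ev : v = v'.
  have e1 := congr1 (fun f : {perm T} => f (F 3)) e.
  rewrite /= !permM (fx3 _ uD) (fx3 _ u'D) in e1.
  by have [h1 h2] := quo _ _ _ _ vC v'C e1; apply/eqP; rewrite eq_mulgV1 (c_free h1 (or_introl h2)).
by move: e; rewrite ev => /mulIg.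
Qed.

Lemma rotation_order_ge i A : 0 < i < 5 -> aut A -> A (F i.+1) = o i.+1 -> A (o i) = F i ->
  A (F i.-1) = F i.-1 -> A (F i.+2) = F i.+2 -> p i <= #[A].
Proof.
move=> iN aA h1 h2 h3 h4.
have [Fi Fl] := fF.
apply: leq_trans (order_rotation poly fF iN aA h1 h2 h3 h4).
have e1 := Fi i.-1 ltac:(lia); have e2 := Fi i.+2 ltac:(lia).
rewrite -(equi (i := i) _ (F := F i.-1) (G := F i.+2)); first last.
- by rewrite (rk_idx poly) e2; lia.
- by rewrite (rk_idx poly) e1; lia.
- by apply: Fl; lia.
- by lia.
apply: eq_leq; apply: eq_card => x; rewrite !inE -andbA; congr [&& _, _ & _].
by rewrite (rk_idx poly); apply/eqP/eqP; lia.
Qed.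

(** By counting: tightness and [card_aut] bound the group by the product of the [p i], the rotations
    have order at least [p i], and distinct factors give distinct products. *)
Lemma factorization f : aut f -> exists u v s t,
  [/\ u \in <[d]>, v \in <[c]>, s \in <[b]>, t \in <[a]> & f = u * v * s * t].
Proof.
move=> af.
pose X := setX (setX (setX <[d]> <[c]>) <[b]>) <[a]>.
pose h (z : {perm T} * {perm T} * {perm T} * {perm T}) := z.1.1.1 * z.1.1.2 * z.1.2 * z.2.
have injh : {in X &, injective h}.
  move=> [[[u v] s] t] [[[u' v'] s'] t'] /setXP [/setXP [/setXP [/= h1 h2] /= h3] /= h4].
  move=> /setXP [/setXP [/setXP [/= h1' h2'] /= h3'] /= h4'] e.
  by have [-> -> -> ->] := normal_form_inj h1 h1' h2 h2' h3 h3' h4 h4' e.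
pose Gam := [set f | aut f].
have sub : h @: X \subset Gam.
  apply/subsetP => y /imsetP [[[[u v] s] t] /setXP [/setXP [/setXP [/= h1 h2] /= h3] /= h4] ->].
  by rewrite inE /h /= !autM //; [exact: cyc_aut h1 _ | exact: cyc_aut h2 _ | exact: cyc_aut h3 _ | exact: cyc_aut h4 _].
have le1 : #|Gam| <= p 1 * p 2 * p 3 * p 4.
  have := card_aut poly chir fF isT; rewrite tigh mulnC leq_pmul2l //.
  by do 4!rewrite big_ltn //; rewrite big_geq // muln1 !mulnA.
have pa : p 1 <= #[a] by apply: rotation_order_ge => //; apply: aF.
have pb : p 2 <= #[b] by apply: rotation_order_ge => //; apply: bF.
have pc : p 3 <= #[c] by apply: rotation_order_ge => //; apply: cF.
have pd : p 4 <= #[d] by apply: rotation_order_ge => //; apply: dF.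
have le2 : #|Gam| <= #|h @: X|.
  rewrite (card_in_imset injh) !cardsX -!orderE; apply: leq_trans le1 _.
  have -> : (#[d] * #[c] * #[b] * #[a] = #[a] * #[b] * #[c] * #[d])%N by lia.
  by rewrite !leq_mul.
have : f \in h @: X by rewrite (eqP (_ : h @: X == Gam)) ?inE // eqEcard sub.
case/imsetP => [[[[u v] s] t] /setXP [/setXP [/setXP [/= h1 h2] /= h3] /= h4] ->].
by exists u, v, s, t.
Qed.

Lemma fix_a g k : g \in <[a]> -> k <= 6 -> k != 1%N -> k != 2 -> g (F k) = F k.
Proof. by move=> h *; apply: cyc_fix h _; apply: aF. Qed.

Lemma fix_b g k : g \in <[b]> -> k <= 6 -> k != 2 -> k != 3 -> g (F k) = F k.
Proof. by move=> h *; apply: cyc_fix h _; apply: bF. Qed.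

Lemma fix_c g k : g \in <[c]> -> k <= 6 -> k != 3 -> k != 4 -> g (F k) = F k.
Proof. by move=> h *; apply: cyc_fix h _; apply: cF. Qed.

Lemma fix_d g k : g \in <[d]> -> k <= 6 -> k != 4 -> k != 5 -> g (F k) = F k.
Proof. by move=> h *; apply: cyc_fix h _; apply: dF. Qed.

Section Factors.
Variables u v s t : {perm T}.
Hypothesis uD : u \in <[d]>.
Hypothesis vC : v \in <[c]>.
Hypothesis sB : s \in <[b]>.
Hypothesis tA : t \in <[a]>.

Lemma factors_fix1 : (u * v * s * t) (F 1) = F 1 -> t = 1.
Proof. by rewrite !permM (fix_d uD) // (fix_c vC) // (fix_b sB) //; apply: a_free. Qed.

Lemma factors_fix5 : (u * v * s * t) (F 5) = F 5 -> u = 1.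
Proof.
move=> e; apply: d_free => //; apply: (@perm_inj _ (v * s * t)).
by rewrite -permM !mulgA e !permM (fix_c vC) // (fix_b sB) // (fix_a tA).
Qed.

End Factors.

(** Factoring the inverse of [z] puts the factors into the order [a, b]; the fixed faces eliminate
    [d] and [c]. *)
Lemma factor_ab z : aut z -> z (F 4) = F 4 -> z (F 5) = F 5 -> z \in <[a]> * <[b]>.
Proof.
move=> az z4 z5; have [u [v [s [t [uD vC sB tA e]]]]] := factorization (autV az).
have zV k : z (F k) = F k -> z^-1 (F k) = F k by move=> h; rewrite -[in LHS]h permK.
have u1 : u = 1 by apply: (factors_fix5 uD vC sB tA); rewrite -e zV.
have v1 : v = 1.
  apply: c_free => //; right; apply: (@perm_inj _ (s * t)); have := zV _ z4.
  by rewrite e u1 mul1g -permM mulgA => ->; rewrite permM (fix_b sB) // (fix_a tA).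
rewrite -[z]invgK e u1 v1 !mul1g invMg; apply: mem_mulg; by rewrite groupV.
Qed.

Lemma factor_bc z : aut z -> z (F 1) = F 1 -> z (F 5) = F 5 -> z \in <[b]> * <[c]>.
Proof.
move=> az z1 z5; have [u [v [s [t [uD vC sB tA e]]]]] := factorization (autV az).
have zV k : z (F k) = F k -> z^-1 (F k) = F k by move=> h; rewrite -[in LHS]h permK.
have u1 : u = 1 by apply: (factors_fix5 uD vC sB tA); rewrite -e zV.
have t1 : t = 1 by apply: (factors_fix1 uD vC sB tA); rewrite -e zV.
rewrite -[z]invgK e u1 t1 mul1g mulg1 invMg; apply: mem_mulg; by rewrite groupV.
Qed.

Lemma factor_cd z : aut z -> z (F 1) = F 1 -> z (F 2) = F 2 -> z \in <[c]> * <[d]>.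
Proof.
move=> az z1 z2; have [u [v [s [t [uD vC sB tA e]]]]] := factorization (autV az).
have zV k : z (F k) = F k -> z^-1 (F k) = F k by move=> h; rewrite -[in LHS]h permK.
have t1 : t = 1 by apply: (factors_fix1 uD vC sB tA); rewrite -e zV.
have s1 : s = 1.
  by apply: b_free => //; have := zV _ z2; rewrite e t1 mulg1 !permM (fix_d uD) // (fix_c vC).
rewrite -[z]invgK e s1 t1 !mulg1 invMg; apply: mem_mulg; by rewrite groupV.
Qed.

(** The stabilizer of the base vertex and the base facet; by [factor_bc] its elements lie in
    [<b><c>]. *)
Definition Hset := [set f | [&& aut f, f (F 1) == F 1 & f (F 5) == F 5]].

Lemma Hset_group : group_set Hset.
Proof.
apply/group_setP; split; first by rewrite inE aut1 !perm1 !eqxx.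
move=> f g; rewrite !inE => /and3P [af /eqP f1 /eqP f5] /and3P [ag /eqP g1 /eqP g5].
by rewrite autM // !permM f1 f5 g1 g5 !eqxx.
Qed.

Lemma cycle_prod (x y z : {perm T}) : z \in <[x]> * <[y]> -> exists m n, z = x ^+ m * y ^+ n.
Proof. by case/mulsgP => ? ? /cycleP [m ->] /cycleP [n ->] ->; exists m, n. Qed.

Lemma middle_regular : exists i j, c^-1 * b = b ^+ i * c ^+ j /\ b * c^-1 = c ^+ j * b ^+ i.
Proof.
have inv (f : {perm T}) x : f x = x -> f^-1 x = x by move=> h; rewrite -[in LHS]h permK.
apply: (two_sided (H := Group Hset_group) rel_ab rel_bc rel_cd rel_abc rel_bcd rel_abcd).
- by rewrite inE autB !bF ?eqxx.
- by rewrite inE autC !cF ?eqxx.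
- by move=> z zA; rewrite inE => /and3P [_ /eqP z1 _]; apply: a_free.
- by move=> z zD; rewrite inE => /and3P [_ _ /eqP z5]; apply: d_free.
- by move=> z zB zC; apply: b_free => //; apply: (fix_c zC).
- move=> z; rewrite inE => /and3P [az /eqP z1 /eqP z5].
  by apply: cycle_prod; apply: factor_bc.
- apply: cycle_prod; apply: factor_ab; first by rewrite autM ?autV.
    by rewrite permM inv ?aF // bF.
  by rewrite permM inv ?aF // bF.
have [m [n e]] : exists m n, d * c^-1 = c ^+ m * d ^+ n.
  apply: cycle_prod; apply: factor_cd; first by rewrite autM ?autV.
    by rewrite permM dF // inv // cF.
  by rewrite permM dF // inv // cF.
by exists n, m.
Qed.

Lemma expX_fix (A : {perm T}) n x : A x = x -> (A ^+ n) x = x.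
Proof. by apply: cyc_fix; apply: mem_cycle. Qed.

Lemma fixV (f : {perm T}) x : f x = x -> f^-1 x = x.
Proof. by move=> h; rewrite -[in LHS]h permK. Qed.

Lemma baX n : b * a ^+ n \in <[a]> * <[b]>.
Proof.
have aX : aut (a ^+ n) by apply: cyc_aut (mem_cycle _ _) autA.
apply: factor_ab; first by rewrite autM.
  by rewrite permM bF // expX_fix // aF.
by rewrite permM bF // expX_fix // aF.
Qed.

Lemma dcX n : d * c ^+ n \in <[c]> * <[d]>.
Proof.
have cX : aut (c ^+ n) by apply: cyc_aut (mem_cycle _ _) autC.
apply: factor_cd; first by rewrite autM.
  by rewrite permM dF // expX_fix // cF.
by rewrite permM dF // expX_fix // cF.
Qed.

(** * The reflection acting on faces *)

Section Reflection.
Variables i j : nat.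
Hypothesis cVb : c^-1 * b = b ^+ i * c ^+ j.
Hypothesis bcV : b * c^-1 = c ^+ j * b ^+ i.
Local Notation M := (mirror_group a b c d).
Local Notation a' := (b^-1 * a^-1 * b).
Local Notation d' := (c * d^-1 * c^-1).

Lemma mirror_pair g h : (g, h) \in M -> exists m n k l,
  g = d ^+ m * c ^+ n * b ^+ k * a ^+ l /\ h = d' ^+ m * c^-1 ^+ n * b^-1 ^+ k * a' ^+ l.
Proof.
case/(mirror_factors rel_ab rel_bc rel_cd rel_abc rel_bcd rel_abcd rel_da baX dcX cVb bcV).
move=> m [n [k [l e]]]; exists m, n, k, l; move: e.
by rewrite /mirA /mirB /mirC /mirD !pairX !pairM => -[-> ->].
Qed.

Lemma mirA_one l : a ^+ l = 1 -> a' ^+ l = 1.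
Proof.
move=> e; have -> : a' = a^-1 ^ b by rewrite conjgE mulgA.
by rewrite -conjXg expgVn e invg1 conj1g.
Qed.

Lemma mirD_one m : d ^+ m = 1 -> d' ^+ m = 1.
Proof.
move=> e; have -> : d' = d^-1 ^ c^-1 by rewrite conjgE invgK mulgA.
by rewrite -conjXg expgVn e invg1 conj1g.
Qed.

Lemma mirror_aut g h : (g, h) \in M -> aut g /\ aut h.
Proof.
have X (A : {perm T}) n : aut A -> aut (A ^+ n) by apply: cyc_aut; apply: mem_cycle.
case/mirror_pair => m [n [k [l [-> ->]]]]; split; rewrite ?autM ?X ?autV //.
- by rewrite ?autM ?autV.
- by rewrite ?autM ?autV.
Qed.

(** Unique factorization makes each of the four powers in the first component trivial; those in the
    second are inverses of them, up to conjugation. *)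
Lemma mirror_one h : (1, h) \in M -> h = 1.
Proof.
case/mirror_pair => m [n [k [l [e ->]]]].
have [e1 e2 e3 e4] : [/\ d ^+ m = 1, c ^+ n = 1, b ^+ k = 1 & a ^+ l = 1].
  by apply: normal_form_inj; rewrite ?mem_cycle ?group1 // -e !mulg1.
by rewrite mirD_one // mirA_one // !expgVn e2 e3 !invg1 !mulg1.
Qed.

Lemma mirror_fun g h h' : (g, h) \in M -> (g, h') \in M -> h = h'.
Proof.
move=> e1 e2; apply/eqP; rewrite eq_mulVg1; apply/eqP; apply: mirror_one.
by have := groupM (groupVr e1) e2; rewrite pairV pairM mulVg.
Qed.

Lemma mirror_dom g : aut g -> exists h, (g, h) \in M.
Proof.
have [AM BM CM DM] := mirror_group_gens a b c d.
case/factorization => u [v [s [t [/cycleP [m ->] /cycleP [n ->] /cycleP [k ->] /cycleP [l ->] ->]]]].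
have := groupM (groupM (groupM (groupX m DM) (groupX n CM)) (groupX k BM)) (groupX l AM).
by rewrite /mirA /mirB /mirC /mirD !pairX !pairM => e; eexists; exact: e.
Qed.

Lemma aut_fix0 f : aut f -> f (F 0) = F 0.
Proof.
move=> af; apply/esym; apply: (le_idx_eq poly); last by rewrite (aut_idx poly af).
exact: (least_flag poly).
Qed.

Lemma aut_fix6 f : aut f -> f (F 6) = F 6.
Proof.
move=> af; apply: (le_idx_eq poly); last by rewrite (aut_idx poly af).
exact: (greatest_flag poly).
Qed.

Local Notation Fp := (upd F 3 (o 3)).

(** Only [F 1] and [F 3] can move. If [F 1] is fixed, [s] is trivial by chirality; otherwise it goes
    to [o 1], which [a b] takes back, and the same argument applies to [s (a b)]. *)
Lemma stabilizer_F2 s : aut s -> s (F 2) = F 2 -> s (F 4) = F 4 -> s (F 5) = F 5 -> s = 1 \/ s = a * b.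
Proof.
move=> as_ s2 s4 s5.
have fx g : aut g -> g (F 1) = F 1 -> g (F 2) = F 2 -> g (F 4) = F 4 -> g (F 5) = F 5 -> g = 1.
  move=> ag g1 g2 g4 g5; apply: (fix_but_one (k0 := 3)) => //.
  by apply: upto6 => //; [move=> _; apply: aut_fix0 | move=> _; apply: aut_fix6].
have [s1|/eqP ns1] := eqVneq (s (F 1)) (F 1); first by left; apply: fx.
have so : s (F 1) = o 1 by apply: (fix_or_other poly fF) => //; apply: aut_fix0.
right; have e : s * (a * b) = 1.
  apply: fx; rewrite ?permM ?autM //.
  - by rewrite so a1 bF.
  - by rewrite s2 a2 b2.
  - by rewrite s4 aF // bF.
  - by rewrite s5 aF // bF.
by apply: (mulIg (a * b)); rewrite e rel_ab.
Qed.

Lemma stabilizer_F3 s : aut s -> s (F 1) = F 1 -> s (F 3) = F 3 -> s (F 5) = F 5 -> s = 1 \/ s = b * c.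
Proof.
move=> as_ s1 s3 s5.
have fx g : aut g -> g (F 1) = F 1 -> g (F 2) = F 2 -> g (F 3) = F 3 -> g (F 5) = F 5 -> g = 1.
  move=> ag g1 g2 g4 g5; apply: (fix_but_one (k0 := 4)) => //.
  by apply: upto6 => //; [move=> _; apply: aut_fix0 | move=> _; apply: aut_fix6].
have [s2|/eqP ns2] := eqVneq (s (F 2)) (F 2); first by left; apply: fx.
have so : s (F 2) = o 2 by apply: (fix_or_other poly fF).
right; have e : s * (b * c) = 1.
  apply: fx; rewrite ?permM ?autM //.
  - by rewrite s1 bF // cF.
  - by rewrite so b2 cF.
  - by rewrite s3 b3 c3.
  - by rewrite s5 bF // cF.
by apply: (mulIg (b * c)); rewrite e rel_bc.
Qed.

Lemma stabilizer_F4 s : aut s -> s (F 1) = F 1 -> s (F 2) = F 2 -> s (F 4) = F 4 -> s = 1 \/ s = c * d.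
Proof.
move=> as_ s1 s2 s4.
have fx g : aut g -> g (F 1) = F 1 -> g (F 2) = F 2 -> g (F 4) = F 4 -> g (F 5) = F 5 -> g = 1.
  move=> ag g1 g2 g4 g5; apply: (fix_but_one (k0 := 3)) => //.
  by apply: upto6 => //; [move=> _; apply: aut_fix0 | move=> _; apply: aut_fix6].
have [s5|/eqP ns5] := eqVneq (s (F 5)) (F 5); first by left; apply: fx.
have so : s (F 5) = o 5 by apply: (fix_or_other poly fF) => //; apply: aut_fix6.
right; have e : s * (c * d)^-1 = 1.
  apply: fx; rewrite ?permM ?autM ?autV ?autM //.
  - by rewrite s1; apply: fixV; rewrite permM cF // dF.
  - by rewrite s2; apply: fixV; rewrite permM cF // dF.
  - by rewrite s4; apply: fixV; rewrite permM c4 d4.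
  - have e5 : (c * d) (F 5) = o 5 by rewrite permM cF // d5.
    by rewrite so -e5 permK.
by apply/eqP; rewrite eq_mulgV1 e.
Qed.

(** This makes the reflection well defined on faces. For [k] equal to 2, 3 or 4, the factors of [g]
    that fix [F k] anyway are split off. The rest fixes enough base faces to be 1 or [a b], [b c],
    [c d] respectively, whose mirror image fixes [Fp k]. *)
Lemma mirror_stab g h k : (g, h) \in M -> k <= 6 -> g (F k) = F k -> h (Fp k) = Fp k.
Proof.
move=> gh kn; have [ag ah] := mirror_aut gh.
have [AM BM CM DM] := mirror_group_gens a b c d.
have [m [n [k' [l [eg eh]]]]] := mirror_pair gh.
have aV q : q <= 6 -> q != 1%N -> q != 2 -> a^-1 (F q) = F q by move=> *; apply: fixV; apply: aF.
have bV q : q <= 6 -> q != 2 -> q != 3 -> b^-1 (F q) = F q by move=> *; apply: fixV; apply: bF.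
have cV q : q <= 6 -> q != 3 -> q != 4 -> c^-1 (F q) = F q by move=> *; apply: fixV; apply: cF.
have dV q : q <= 6 -> q != 4 -> q != 5 -> d^-1 (F q) = F q by move=> *; apply: fixV; apply: dF.
have aC : a ^+ l \in <[a]> by apply: mem_cycle.
have bC : b ^+ k' \in <[b]> by apply: mem_cycle.
have cC : c ^+ n \in <[c]> by apply: mem_cycle.
have dC : d ^+ m \in <[d]> by apply: mem_cycle.
have X (A : {perm T}) q : aut A -> aut (A ^+ q) by apply: cyc_aut; apply: mem_cycle.
have pBA := groupM (groupX k' BM) (groupX l AM).
have pCB := groupM (groupX n CM) (groupX k' BM).
have pDC := groupM (groupX m DM) (groupX n CM).
rewrite /mirA /mirB /mirC /mirD !pairX !pairM in pBA pCB pDC.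
have a'F q : q <= 6 -> q != 1%N -> q != 2 -> q != 3 -> a' (F q) = F q.
  by move=> *; rewrite !permM bV // aV // bF.
have d'F q : q <= 6 -> q != 3 -> q != 4 -> q != 5 -> d' (F q) = F q.
  by move=> *; rewrite !permM cF // dV // cV.
have a'3 : a' (o 3) = o 3 by rewrite -b3 !permM permK aV.
have d'3 : d' (o 3) = o 3.
  have e : c^-1 (F 3) = o 3 by rewrite -c3 permK.
  by rewrite !permM c3 dV // e.
move: k kn; apply: upto6 => gk; rewrite /upd /=.
- exact: aut_fix0.
- have t1 := factors_fix1 dC cC bC aC ltac:(by rewrite -eg).
  rewrite eh mirA_one // mulg1 !permM.
  by rewrite (expX_fix _ (d'F 1%N _ _ _ _)) // (expX_fix _ (cV 1%N _ _ _)) // (expX_fix _ (bV 1%N _ _ _)).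
- have e : (b ^+ k' * a ^+ l) (F 2) = F 2.
    have dc : (d ^+ m * c ^+ n) (F 2) = F 2 by rewrite permM (fix_d dC) ?(fix_c cC).
    by move: gk; rewrite eg -mulgA permM dc.
  have e4 : (b ^+ k' * a ^+ l) (F 4) = F 4 by rewrite permM (fix_b bC) ?(fix_a aC).
  have e5 : (b ^+ k' * a ^+ l) (F 5) = F 5 by rewrite permM (fix_b bC) ?(fix_a aC).
  have dc2 : (d' ^+ m * c^-1 ^+ n) (F 2) = F 2.
    by rewrite permM (expX_fix _ (d'F 2 _ _ _ _)) // (expX_fix _ (cV 2 _ _ _)).
  rewrite eh -mulgA permM dc2.
  have [e'|e'] := stabilizer_F2 (autM (X _ _ autB) (X _ _ autA)) e e4 e5; rewrite e' in pBA.
    by rewrite (mirror_one pBA) perm1.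
  have -> : b^-1 ^+ k' * a' ^+ l = a * b.
    apply: (mirror_fun pBA); have := groupM AM BM; rewrite /mirA /mirB pairM.
    by rewrite mulgK (involutive_mul rel_ab).
  by rewrite permM a2 b2.
- have e1 : (c ^+ n * b ^+ k') (F 1) = F 1 by rewrite permM (fix_c cC) ?(fix_b bC).
  have e5 : (c ^+ n * b ^+ k') (F 5) = F 5 by rewrite permM (fix_c cC) ?(fix_b bC).
  have e3 : (c ^+ n * b ^+ k') (F 3) = F 3.
    apply: (@perm_inj _ (a ^+ l)); rewrite (fix_a aC) // -{2}gk eg !permM (fix_d dC) //.
  have -> : h = d' ^+ m * (c^-1 ^+ n * b^-1 ^+ k') * a' ^+ l by rewrite eh !mulgA.
  rewrite 2!permM (expX_fix _ d'3).
  suff -> : (c^-1 ^+ n * b^-1 ^+ k') (o 3) = o 3 by rewrite (expX_fix _ a'3).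
  have [e'|e'] := stabilizer_F3 (autM (X _ _ autC) (X _ _ autB)) e1 e3 e5; rewrite e' in pCB.
    by rewrite (mirror_one pCB) perm1.
  have -> : c^-1 ^+ n * b^-1 ^+ k' = b^-1 * c^-1.
    by apply: (mirror_fun pCB); have := groupM BM CM; rewrite /mirB /mirC pairM.
  by rewrite permM -{1}b3 permK -c3 permK.
- have e : (d ^+ m * c ^+ n) (F 4) = F 4.
    apply: (@perm_inj _ (b ^+ k' * a ^+ l)); rewrite -permM mulgA -eg gk permM.
    by rewrite (fix_b bC) ?(fix_a aC).
  have e1 : (d ^+ m * c ^+ n) (F 1) = F 1 by rewrite permM (fix_d dC) ?(fix_c cC).
  have e2 : (d ^+ m * c ^+ n) (F 2) = F 2 by rewrite permM (fix_d dC) ?(fix_c cC).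
  have ba4 : (b^-1 ^+ k' * a' ^+ l) (F 4) = F 4.
    by rewrite permM (expX_fix _ (bV 4 _ _ _)) // (expX_fix _ (a'F 4 _ _ _ _)).
  rewrite eh -mulgA permM.
  suff -> : (d' ^+ m * c^-1 ^+ n) (F 4) = F 4 by [].
  have [e'|e'] := stabilizer_F4 (autM (X _ _ autD) (X _ _ autC)) e1 e2 e; rewrite e' in pDC.
    by rewrite (mirror_one pDC) perm1.
  have -> : d' ^+ m * c^-1 ^+ n = c * d.
    apply: (mirror_fun pDC); have := groupM CM DM; rewrite /mirC /mirD pairM.
    by rewrite !mulgA mulVg mul1g -(involutive_mul rel_cd).
  by rewrite permM c4 d4.
- have u1 := factors_fix5 dC cC bC aC ltac:(by rewrite -eg).
  rewrite eh mirD_one // mul1g !permM.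
  by rewrite (expX_fix _ (cV 5 _ _ _)) // (expX_fix _ (bV 5 _ _ _)) // (expX_fix _ (a'F 5 _ _ _ _)).
exact: aut_fix6.
Qed.

(** Two faces leave some shifted rank from 1 to 5 free, and changing a flag through them in that
    rank switches its orbit. *)
Lemma pair_transitive x y : le x y -> exists g, [/\ aut g, g (F (idx rk x)) = x & g (F (idx rk y)) = y].
Proof.
move=> xy.
have chC : is_chain le [set x; y].
  apply/chainP => u v /set2P [->|->] /set2P [->|->]; rewrite /incident ?xy ?(le_refl poly) ?orbT //.
have [G [fG hG]] := chain_flag poly chC.
have Gx := hG x (set21 x y); have Gy := hG y (set22 x y).
have [k [kn kx ky]] : exists k, [/\ 0 < k <= 5, k != idx rk x & k != idx rk y].
  case: (boolP ((1%N != idx rk x) && (1%N != idx rk y))) => [/andP [h1 h2]|h1]; first by exists 1%N.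
  case: (boolP ((2 != idx rk x) && (2 != idx rk y))) => [/andP [h2 h3]|h2]; first by exists 2.
  by exists 3; split=> //; lia.
have [o1 o2 o3 o4] := otherP poly fG kn.
have adj := adjacent_upd poly fG kn o1 o2 o3 o4.
have xn := idx_max poly x; have yn := idx_max poly y.
case: (two_orbits poly chir fF adj) => [[g ag hg]|[g ag hg]]; exists g.
  by split=> //; rewrite hg.
by split=> //; rewrite hg // /upd eq_sym ?(negbTE kx) ?(negbTE ky).
Qed.

(** Faces of one rank are cosets of the stabilizer of a base face, and a mirror pair [(g, h)]
    carries [g (F k)] to [h (Fp k)]. The default [x] is never reached, by [pair_transitive] and
    [mirror_dom]. *)
Definition reflect_face x : T := odflt x [pick y |
  [exists z, [&& z \in M, z.1 (F (idx rk x)) == x & y == z.2 (Fp (idx rk x))]]].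

Lemma reflect_faceE g h k : (g, h) \in M -> k <= 6 -> reflect_face (g (F k)) = h (Fp k).
Proof.
move=> gh kn; have [ag ah] := mirror_aut gh; have [Fi Fl] := fF.
have ik : idx rk (g (F k)) = k by rewrite (aut_idx poly ag) Fi.
rewrite /reflect_face ik; case: pickP => [y /existsP [[g' h'] /and3P [g'h' /eqP e /eqP ->]] /= | /(_ (h (Fp k)))].
  have st : (g' * g^-1, h' * h^-1) \in M by have := groupM g'h' (groupVr gh); rewrite pairV pairM.
  have := mirror_stab st kn; rewrite permM e permK => /(_ erefl).
  by rewrite permM => /(congr1 h); rewrite permKV.
by move/existsP; case; exists (g, h); rewrite gh /= !eqxx.
Qed.

Lemma Fp_flag : flagfun le rk 5 Fp.
Proof.
have [o1 o2 o3 o4] := otherP poly fF (k := 3) isT.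
exact: (upd_flag poly).
Qed.

Lemma reflect_face_le x y : le x y -> le (reflect_face x) (reflect_face y).
Proof.
move=> xy; have [g [ag gx gy]] := pair_transitive xy; have [h gh] := mirror_dom ag.
rewrite -gx -gy !(reflect_faceE gh) ?(idx_max poly) //.
have [_ ah] := mirror_aut gh; rewrite aut_le //.
by have [_ Fl] := Fp_flag; apply: Fl; rewrite ?(le_idx poly) ?(idx_max poly).
Qed.

Lemma reflect_faceK : involutive reflect_face.
Proof.
move=> x; have [g [ag gx _]] := pair_transitive (le_refl poly x); have [h gh] := mirror_dom ag.
have kn := idx_max poly x; set k := idx rk x in gx kn.
rewrite -gx (reflect_faceE gh) // {1}/upd.
have hg := mirror_group_swap gh.
have [k3|k3] := eqVneq k 3; last by rewrite (reflect_faceE hg) // /upd (negbTE k3).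
have [_ BM _ _] := mirror_group_gens a b c d.
(* In rank 3 the image [h (o 3)] is not given through the base face [F 3]; as [o 3 = b (F 3)], the
   pair is first multiplied by [mirB]. *)
have bhg : (b * h, b^-1 * g) \in M by have := groupM BM hg; rewrite /mirB pairM.
have -> : h (o 3) = (b * h) (F 3) by rewrite permM b3.
by rewrite (reflect_faceE bhg) // /upd eqxx permM -b3 permK k3.
Qed.

Lemma reflection_contradiction : False.
Proof.
pose f := perm (inv_inj reflect_faceK).
have af : aut f.
  apply/forallP => x; apply/forallP => y; apply/eqP; rewrite !permE.
  apply/idP/idP => [h|]; last exact: reflect_face_le.
  by rewrite -[x]reflect_faceK -[y]reflect_faceK reflect_face_le.
have [o1 o2 o3 o4] := otherP poly fF (k := 3) isT.
have adj := adjacent_upd poly fF (k := 3) isT o1 o2 o3 o4.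
apply: (adjacent_not_equivalent poly chir adj af) => k kn.
rewrite permE -[F k](perm1); have -> := @reflect_faceE 1 1 k _ kn; first by rewrite perm1.
exact: group1.
Qed.

End Reflection.

Lemma no_tight_chiral_rotations : False.
Proof. by have [i [j [e1 e2]]] := middle_regular; apply: (reflection_contradiction e1 e2). Qed.

End TightChiral.

Theorem theorem1p1 :
  forall (T : finType) (le : rel T) (rk : T -> int) (p : nat -> nat),
    is_polytope le rk 5 -> equivelar le rk 5 p -> chiral le ->
    ~ tight le 5 p.
Proof.
move=> T le rk p poly equi chir tigh.
have ch0 : is_chain le (set0 : {set T}) by apply/chainP => x y; rewrite inE.
have [F [fF _]] := chain_flag poly ch0.
have [a [autA a1 a2 aF]] := rotation_exists poly chir fF (i := 1) isT.
have [b [autB b1 b2 bF]] := rotation_exists poly chir fF (i := 2) isT.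
have [c [autC c1 c2 cF]] := rotation_exists poly chir fF (i := 3) isT.
have [d [autD d1 d2 dF]] := rotation_exists poly chir fF (i := 4) isT.
exact: (no_tight_chiral_rotations poly equi chir tigh fF autA autB autC autD a1 a2 aF b1 b2 bF c1 c2 cF d1 d2 dF).
Qed.
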